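(* Let $a\in[n-1]$ and let $z,z'$ be $w_0$-normalized BZ-data such that $f_aP(z)=P(z')$. Then for all $S\subset[n]$ $$z_S-z'_S=\begin{cases}1&\text{if }a\in S,\ a+1\notin S\text{ and }z_S-z_{\sigma_aS}\ge z_{[a]}-z_{\sigma_a[a]},\\0&\text{else.}\end{cases}$$ Furthermore, if $a\in S$ and $a+1\notin S$, then $$z_S-z_{\sigma_aS}\le z_{[a]}-z_{\sigma_a[a]}.$$
   Context: Let $n\ge2$, $[m]=\{1,\dots,m\}$, $N=n(n-1)/2$, $W=\mathfrak S_n$ with simple reflections $\sigma_i=(i,i+1)$ and longest element $w_0$, acting on $[n]$ and on its subsets. For $a\in S$, $a+1\notin S$ we have $\sigma_aS=(S\setminus\{a\})\cup\{a+1\}$. Let $\alpha_a$ be the simple roots of $\mathfrak{sl}_n(\mathbb C)$, $\epsilon_s$ the $s$-th diagonal-entry functional, $v_S=\sum_{s\in S}\epsilon_s$ (chamber weights), $\mathfrak h_{\mathbb R}$ the real span of the roots, with the standard pairing. **BZ-data and MV polytopes.** A $w_0$-normalized BZ-datum is a family of integers $z=(z_S)$ indexed by the non-empty proper subsets $S\subset[n]$, with the convention $z_\emptyset=z_{[n]}=0$, such that: (i) $z_{w_0[a]}=0$ for all $a\in[n-1]$; (ii) $z_{\sigma[a]}+z_{\sigma\sigma_a[a]}+\sum_{b\in[n-1]\setminus\{a\}}\langle\alpha_a,\alpha_b\rangle z_{\sigma[b]}\le0$ for all $\sigma\in W$, $a\in[n-1]$; (iii) for $\sigma\in W$ and $a,b\in[n-1]$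 with $|a-b|=1$, $\sigma\sigma_a>\sigma$, $\sigma\sigma_b>\sigma$: $z_{\sigma\sigma_a[a]}+z_{\sigma\sigma_b[b]}=\min(z_{\sigma[a]}+z_{\sigma\sigma_a\sigma_b[b]},\,z_{\sigma[b]}+z_{\sigma\sigma_b\sigma_a[a]})$. The associated Mirković–Vilonen polytope is $P(z)=\{h\in\mathfrak h_{\mathbb R}\mid\langle h,v_S\rangle\ge z_S\ \forall S\}$. **Tilings.** A tiling is a tiling of the regular $2n$-gon $P_0$ of side length $1$ (placed with a unique lowest vertex $v_0$) by rhombi (tiles) of side length $1$. The left boundary runs clockwise from $v_0$ to the highest vertex; its edges are labelled $1,\dots,n$ clockwise from $v_0$, and parallel edges of the tiling have equal labels. A vertex is written $v_S$, $S\subseteq[n]$ the set of labels of a minimal edge path from $v_0$ to it. For $s\ne t$ there is exactly one tile with edges labelled $s,t$, denoted $[s,t]=[s,t;S]$, with vertices $v_S,v_{S\cup\{s\}},v_{S\cup\{t\}},v_{S\cup\{s,t\}}$. For $T=[s,t;S]$ with $s<t$: $u(T)=S$, $o(T)=S\cup\{s,t\}$, $\ell(T)=S\cup\{s\}$, $r(T)=S\cup\{t\}$. Define $\le_n$ on tiles as follows: let $B_1$ be the left boundary; $\mathcal T_k$ is the set of tiles not in $\mathcal T_1\cup\dots\cup\mathcal T_{k-1}$ having two edges in $B_k$; $B_{k+1}$ arises from $B_k$ by replacing for each tile of $\mathcal T_k$ these two edges by its other two edges. $T\le_nT'$ iff there is a sequence of tiles from $T$ to $T'$, consecutive ones sharing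 an edge, along which the index $k$ strictly increases. A reduced word is $\mathbf i=(i_1,\dots,i_N)$ with $\sigma_{i_1}\cdots\sigma_{i_N}=w_0$; it gives the total order $\alpha_{i_1}\le_{\mathbf i}\sigma_{i_1}(\alpha_{i_2})\le_{\mathbf i}\cdots\le_{\mathbf i}\sigma_{i_1}\cdots\sigma_{i_{N-1}}(\alpha_{i_N})$ on positive roots. $\mathcal T_{\mathbf i}$ is the unique tiling such that $\le_{\mathbf i}$ refines $\le_n$ when $[s,t]$ ($s<t$) is identified with $\epsilon_s-\epsilon_t$. **Crystal structure.** Transition maps $\phi^{\mathbf i}_{\mathbf j}:\mathbb N^{\mathcal T_{\mathbf i}}\to\mathbb N^{\mathcal T_{\mathbf j}}$: for a commutation move, $(\phi x)_{[s,t]}=x_{[s,t]}$; for a braid move, $\mathcal T_{\mathbf j}$ is obtained by flipping a hexagon formed by tiles $[s,t],[s,u],[t,u]$ ($s<t<u$), and $y=\phi x$ has $y_{[s,t]}=x_{[s,t]}+x_{[s,u]}-m$, $y_{[s,u]}=m$, $y_{[t,u]}=x_{[t,u]}+x_{[s,u]}-m$ with $m=\min(x_{[s,t]},x_{[t,u]})$, other coordinates unchanged; in general compose. The Kashiwara operator $f_a$ on $\mathbb N^{\mathcal T_{\mathbf i}}$: if $i_1=a$ it increases $x_{[a,a+1]}$ by one; in general $f_a=\phi^{\mathbf j}_{\mathbf i}\circ f_a\circ\phi^{\mathbf i}_{\mathbf j}$. The map $P(z)\mapsto\left(z_{o(T)}+z_{u(T)}-z_{\ell(T)}-z_{r(T)}\right)_{T\in\mathcal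 T_{\mathbf i}}$ is, for every $\mathbf i$, a bijection from MV polytopes to $\mathbb N^{\mathcal T_{\mathbf i}}$, and the operator $f_a$ on MV polytopes is the one corresponding to $f_a$ on $\mathbb N^{\mathcal T_{\mathbf i}}$ under this bijection (independently of $\mathbf i$). *)

(* Defs.v *)
From mathcomp Require Import classical_sets reals.
From mathcomp Require Import all_boot all_order all_algebra all_fingroup.
From mathcomp Require Import trigo.

Set Implicit Arguments.
Unset Strict Implicit.
Unset Printing Implicit Defensive.

Import Order.TTheory GRing.Theory Num.Theory.
Local Open Scope ring_scope.

(* The label k of [n] = {1, ..., n} is the ordinal of value k - 1; the index a
   of [n-1] is likewise the element of 'I_n.-1 of value a - 1.  For such an a,
   [lo a] and [hi a] are the labels a and a + 1. *)

Lemma hi_subproof n (a : 'I_n.-1) : (a.+1 < n)%N.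
Proof. by case: n a => [|n] [] //=. Qed.

Definition lo n (a : 'I_n.-1) : 'I_n := widen_ord (leq_pred n) a.
Definition hi n (a : 'I_n.-1) : 'I_n := Ordinal (hi_subproof a).

(* [init k] is {1, ..., k}; [seg a] is the set [a] of the labels up to a. *)
Definition init n (k : nat) : {set 'I_n} := [set i : 'I_n | (i < k)%N].
Definition seg n (a : 'I_n.-1) : {set 'I_n} := init n a.+1.

Definition adjacent n (a b : 'I_n.-1) : bool :=
  (a.+1 == b :> nat) || (b.+1 == a :> nat).

(* -- The symmetric group ------------------------------------------------- *)

(* In MathComp (s * t)%g applies s first; [wmul s t] is the composite that
   applies t first. *)
Definition wmul n (s t : 'S_n) : 'S_n := (t * s)%g.
Definition sigma n (a : 'I_n.-1) : 'S_n := tperm (lo a) (hi a).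
Definition w0 n : 'S_n := perm (@rev_ord_inj n).
Definition wset n (s : 'S_n) (S : {set 'I_n}) : {set 'I_n} := s @: S.

(* Coxeter length of a permutation: its number of inversions.  Two elements
   s and s sigma_a are comparable in the Bruhat order, and the order between
   them is that of their lengths. *)
Definition wlength n (s : 'S_n) : nat :=
  #|[set p : 'I_n * 'I_n | (p.1 < p.2)%N && (s p.2 < s p.1)%N]|.
Definition ascent n (s : 'S_n) (a : 'I_n.-1) : bool :=
  (wlength s < wlength (wmul s (sigma a)))%N.

(* -- Roots and weights --------------------------------------------------- *)

Definition eps (A : pzRingType) n (s : 'I_n) : 'rV[A]_n := delta_mx 0 s.
Definition root_vec (A : pzRingType) n (s t : 'I_n) : 'rV[A]_n :=
  eps A s - eps A t.
Definition simple_root (A : pzRingType) n (a : 'I_n.-1) : 'rV[A]_n :=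
  root_vec A (lo a) (hi a).
Definition chamber_weight (A : pzRingType) n (S : {set 'I_n}) : 'rV[A]_n :=
  \sum_(s in S) eps A s.
Definition pairing (A : pzRingType) n (u v : 'rV[A]_n) : A :=
  \sum_k u 0 k * v 0 k.
Definition wact (A : pzRingType) n (s : 'S_n) (v : 'rV[A]_n) : 'rV[A]_n :=
  \sum_k v 0 k *: eps A (s k).

(* -- BZ-data and MV polytopes -------------------------------------------- *)

Definition BZ_datum n (z : {set 'I_n} -> int) : Prop :=
  [/\ z set0 = 0 /\ z [set: 'I_n] = 0,
      forall a : 'I_n.-1, z (wset (w0 n) (seg a)) = 0,
      forall (s : 'S_n) (a : 'I_n.-1),
        z (wset s (seg a)) + z (wset (wmul s (sigma a)) (seg a))
        + \sum_(b | b != a)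
            pairing (simple_root int a) (simple_root int b) * z (wset s (seg b))
        <= 0
    & forall (s : 'S_n) (a b : 'I_n.-1),
        adjacent a b -> ascent s a -> ascent s b ->
        z (wset (wmul s (sigma a)) (seg a))
          + z (wset (wmul s (sigma b)) (seg b))
        = Num.min
            (z (wset s (seg a))
               + z (wset (wmul (wmul s (sigma a)) (sigma b)) (seg b)))
            (z (wset s (seg b))
               + z (wset (wmul (wmul s (sigma b)) (sigma a)) (seg a)))].

Definition root_span (R : realType) n : set 'rV[R]_n :=
  [set h | exists c : 'I_n * 'I_n -> R,
      h = \sum_p c p *: root_vec R p.1 p.2]%classic.

Definition MV_polytope (R : realType) n (z : {set 'I_n} -> int)
    : set 'rV[R]_n :=
  [set h | @root_span R n h /\
      forall S : {set 'I_n}, (z S)%:~R <= pairing h (chamber_weight R S)]%classic.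
Arguments MV_polytope R {n} z.

(* -- Tiles --------------------------------------------------------------- *)

(* The tile [s,t;S] with s < t is the triple (s, t, S). *)
Definition tile n : finType := ('I_n * 'I_n * {set 'I_n})%type.
Definition tmin n (T : tile n) : 'I_n := T.1.1.
Definition tmax n (T : tile n) : 'I_n := T.1.2.

Definition uvert n (T : tile n) : {set 'I_n} := T.2.
Definition lvert n (T : tile n) : {set 'I_n} := tmin T |: T.2.
Definition rvert n (T : tile n) : {set 'I_n} := tmax T |: T.2.
Definition overt n (T : tile n) : {set 'I_n} := tmin T |: (tmax T |: T.2).

Definition tile_valid n (T : tile n) : bool :=
  [&& (tmin T < tmax T)%N, tmin T \notin uvert T & tmax T \notin uvert T].

(* The edge labelled s from v_S up to v_(S + s) is the pair (S, s). *)
Definition edge n : finType := ({set 'I_n} * 'I_n)%type.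
Definition tile_edges n (T : tile n) : {set edge n} :=
  [set (uvert T, tmin T); (lvert T, tmax T);
       (uvert T, tmax T); (rvert T, tmin T)].
Definition left_boundary n : {set edge n} :=
  [set (init n s, s) | s : 'I_n].

(* -- Tilings of the regular 2n-gon --------------------------------------- *)

Section Geometry.
Variable R : realType.

(* The left boundary of the regular 2n-gon, from the lowest vertex v_0 = (0,0)
   to the highest one, is made of n unit vectors turning clockwise by pi / n;
   the label k is the ordinal of value k - 1 and the k-th edge makes the angle
   pi - (2k - 1) pi / 2n with the horizontal axis. *)
Definition side_angle n (k : 'I_n) : R :=
  pi - (k.*2.+1)%:R * pi / (n.*2)%:R.

(* [plane] sends the indicator function of S to the point v_S. *)
Definition plane n (c : 'I_n -> R) : R * R :=
  (\sum_k c k * cos (side_angle k), \sum_k c k * sin (side_angle k)).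

Definition cube n : set ('I_n -> R) :=
  [set c | forall k, 0 <= c k <= 1]%classic.

(* The regular 2n-gon, as the Minkowski sum of the edges of its left boundary. *)
Definition polygon n : set (R * R) := (@plane n @` @cube n)%classic.

(* A tile [s,t;S] is lifted to the square face of the cube on which the
   coordinates in S are 1 and the other coordinates, but s and t, are 0. *)
Definition tile_lift n (T : tile n) : set ('I_n -> R) :=
  [set c | cube c /\
     forall k, k != tmin T -> k != tmax T -> c k = (k \in uvert T)%:R]%classic.

Definition rhombus n (T : tile n) : set (R * R) :=
  (@plane n @` tile_lift T)%classic.

(* The rhombi cover the polygon, and a point of the plane that lies in several
   of them has the same lift in all of them: rhombi meet only along common
   vertices and edges, and every vertex v_S gets the same label set S from all
   the tiles around it. *)
Definition is_tiling n (TT : {set tile n}) : Prop :=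
  [/\ forall T, T \in TT -> tile_valid T,
      (\bigcup_(T in [set` TT]) rhombus T = @polygon n)%classic
    & forall T T' c c', T \in TT -> T' \in TT ->
        tile_lift T c -> tile_lift T' c' -> plane c = plane c' -> c =1 c'].

End Geometry.

(* -- The order <=_n on the tiles of a tiling ------------------------------ *)

(* [sweep TT k] is the set of the tiles of the first k layers, together with
   the path B_(k+1); layers are numbered from 0 here. *)
Definition layer_of n (TT : {set tile n}) (st : {set tile n} * {set edge n})
    : {set tile n} :=
  [set T in TT | (T \notin st.1) && (#|tile_edges T :&: st.2| == 2)%N].

Fixpoint sweep n (TT : {set tile n}) (k : nat)
    : {set tile n} * {set edge n} :=
  if k is k'.+1 then
    let st := sweep TT k' in
    let L := layer_of TT st in
    let E := \bigcup_(T in L) tile_edges T in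
    (st.1 :|: L, (st.2 :\: E) :|: (E :\: st.2))
  else (set0, left_boundary n).

Definition layer n (TT : {set tile n}) (k : nat) : {set tile n} :=
  layer_of TT (sweep TT k).

Inductive tile_le n (TT : {set tile n}) : tile n -> tile n -> Prop :=
| tile_le_refl T : T \in TT -> tile_le TT T T
| tile_le_step T T' T'' k k' :
    T \in layer TT k -> T' \in layer TT k' -> (k < k')%N ->
    tile_edges T :&: tile_edges T' != set0 ->
    tile_le TT T' T'' -> tile_le TT T T''.

(* -- Reduced words and their tilings -------------------------------------- *)

Definition word n := seq 'I_n.-1.

Definition word_prod n (i : word n) : 'S_n :=
  foldr (fun a s => wmul (sigma a) s) 1%g i.

Definition reduced_word n (i : word n) : Prop :=
  size i = (n * n.-1)./2 /\ word_prod i = w0 n.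

Fixpoint roots_from n (s : 'S_n) (i : word n) : seq 'rV[int]_n :=
  if i is a :: i' then
    wact s (simple_root int a) :: roots_from (wmul s (sigma a)) i'
  else [::].

Definition word_roots n (i : word n) : seq 'rV[int]_n := roots_from 1%g i.

(* For a reduced word, [word_roots] lists every positive root once. *)
Definition root_le n (i : word n) (b c : 'rV[int]_n) : bool :=
  (index b (word_roots i) <= index c (word_roots i))%N.

Definition tile_root n (T : tile n) : 'rV[int]_n := root_vec int (tmin T) (tmax T).

Definition tiling_of (R : realType) n (i : word n) (TT : {set tile n})
    : Prop :=
  is_tiling R TT /\
  forall T T', tile_le TT T T' -> root_le i (tile_root T) (tile_root T').

(* -- The crystal structure ------------------------------------------------ *)

(* A tiling has exactly one tile [s,t] for each s < t, so that the families of
   natural numbers indexed by its tiles are indexed by these pairs. *)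
Definition tpair n : finType := {p : 'I_n * 'I_n | (p.1 < p.2)%N}.
Definition coords n := {ffun tpair n -> nat}.

(* x_[s,t]; only meant for s < t. *)
Definition coord n (x : coords n) (s t : 'I_n) : nat :=
  oapp x 0%N (insub (s, t)).

Definition braid_map n (s t u : 'I_n) (x : coords n) : coords n :=
  let m := minn (coord x s t) (coord x t u) in
  [ffun p : tpair n =>
     if val p == (s, t) then (coord x s t + coord x s u - m)%N
     else if val p == (s, u) then m
     else if val p == (t, u) then (coord x t u + coord x s u - m)%N
     else x p].

(* The two tilings by [s,t], [s,u], [t,u] of the hexagon with lowest vertex
   v_A, for s < t < u. *)
Definition hexagon1 n (s t u : 'I_n) (A : {set 'I_n}) : {set tile n} :=
  [set (s, t, A); (s, u, t |: A); (t, u, A)].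
Definition hexagon2 n (s t u : 'I_n) (A : {set 'I_n}) : {set tile n} :=
  [set (t, u, s |: A); (s, u, A); (s, t, u |: A)].

Definition flip n (s t u : 'I_n) (TT TT' : {set tile n}) : Prop :=
  [/\ (s < t)%N, (t < u)%N
    & exists A : {set 'I_n},
        (hexagon1 s t u A \subset TT /\
         TT' = (TT :\: hexagon1 s t u A) :|: hexagon2 s t u A) \/
        (hexagon2 s t u A \subset TT /\
         TT' = (TT :\: hexagon2 s t u A) :|: hexagon1 s t u A)].

(* [transition i x j y] means that y = phi^i_j(x). *)
Inductive transition (R : realType) n :
    word n -> coords n -> word n -> coords n -> Prop :=
| transition_refl i x : transition R i x i x
| transition_commutation (i i' : word n) (a b : 'I_n.-1) x j y :
    a != b -> ~~ adjacent a b ->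
    transition R (i ++ [:: b; a] ++ i') x j y ->
    transition R (i ++ [:: a; b] ++ i') x j y
| transition_braid (i i' : word n) (a b : 'I_n.-1) TT TT' s t u x j y :
    adjacent a b ->
    tiling_of R (i ++ [:: a; b; a] ++ i') TT ->
    tiling_of R (i ++ [:: b; a; b] ++ i') TT' ->
    flip s t u TT TT' ->
    transition R (i ++ [:: b; a; b] ++ i') (braid_map s t u x) j y ->
    transition R (i ++ [:: a; b; a] ++ i') x j y.

Definition incr n (a : 'I_n.-1) (x : coords n) : coords n :=
  [ffun p : tpair n => (x p + (val p == (lo a, hi a)))%N].

(* [kashiwara a i x y] means that y = f_a(x), for x and y with coordinates
   indexed by the tiles of the tiling of i. *)
Definition kashiwara (R : realType) n (a : 'I_n.-1) (i : word n)
    (x y : coords n) : Prop :=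
  exists (j' : word n) (x' : coords n),
    transition R i x (a :: j') x' /\ transition R (a :: j') (incr a x') i y.

(* [lusztig i z x] means that x is the image of P(z) under the bijection from
   MV polytopes attached to i. *)
Definition lusztig (R : realType) n (i : word n) (z : {set 'I_n} -> int)
    (x : coords n) : Prop :=
  exists TT : {set tile n}, tiling_of R i TT /\
    forall T, T \in TT ->
      (coord x (tmin T) (tmax T))%:Z
      = z (overt T) + z (uvert T) - z (lvert T) - z (rvert T).

(* [MV_kashiwara a P Q] means that f_a P = Q for MV polytopes P and Q; the
   operator does not depend on the reduced word used to compute it. *)
Definition MV_kashiwara (R : realType) n (a : 'I_n.-1) (P Q : set 'rV[R]_n)
    : Prop :=
  exists (i : word n) (z z' : {set 'I_n} -> int) (x y : coords n),
    [/\ reduced_word i,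
        BZ_datum z /\ P = MV_polytope R z,
        BZ_datum z' /\ Q = MV_polytope R z',
        lusztig R i z x /\ lusztig R i z' y
      & kashiwara R a i x y].

(* Main.v *)
Require Import Defs.
From mathcomp Require Import boolp classical_sets reals.
From mathcomp Require Import all_boot all_order all_algebra all_fingroup.
From mathcomp Require Import trigo zify ring lra.

(* A set S containing a but not a + 1 is reached from [a - 1] + a by removing
   labels below a and adding labels above a + 1.  By the three-term tropical
   Pluecker relation, each such step replaces the difference z_S - z_(sigma_a S)
   by its minimum with a quantity that only involves sets T for which (a in T,
   a + 1 notin T) fails.  Hence, if z and z' agree on the latter sets and
   z'_[a] = z_[a] - 1, then z_S - z_(sigma_a S) = min (c, K) and
   z'_S - z'_(sigma_a S) = min (c - 1, K) with c = z_[a] - z_(sigma_a [a]) and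
   the same K, which is the theorem.

   Two BZ-data with the same Lusztig data along a reduced word of sigma_a w_0
   agree on all sets w[k] for w above sigma_a in the weak order, by the
   induction that proves Matsumoto's theorem.  The Lusztig data of z and z' are
   read off the tiling of a word starting with a, whose tile [a, a+1] accounts
   for z'_[a] = z_[a] - 1.

   To identify the tiles of a geometric tiling, points are moved horizontally
   to the right: this shows that every edge off the right boundary is a left
   edge of exactly one tile, so that the tiling is swept by monotone paths, and
   that following the strip of an edge label goes up in the order <=_n. *)

Set Implicit Arguments.
Unset Strict Implicit.
Unset Printing Implicit Defensive.

Import Order.TTheory GRing.Theory Num.Theory.
Local Open Scope ring_scope.

(** * Permutations, inversions and reduced words *)

(** The operator relates polytopes as sets, so a polytope must be shown to determine its datum: the
    inequalities (ii) make z supermodular, and the greedy algorithm then gives a point of the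
    polytope where any chosen bound is attained. Transitions carry tilings and flips as arbitrary
    witnesses, and a tiling is given only through its rhombi; relating [braid_map] to BZ-data
    therefore requires explicit knowledge of the tiles of a word, which is the purpose of the
    geometric part. There a monotone path is a permutation w, its vertices are the sets w[k], and
    crossing a tile is an ascent of w, so that the label pairs of tiles are inversions and a sweep
    is a maximal chain of the weak order. The letters after an initial a belong to tiles other than
    [a, a+1], whose coordinates f_a leaves unchanged; this is the source of the agreement above
    sigma_a. *)

(* The set written w[k] in the paper. *)
Definition pre n (w : 'S_n) (k : nat) : {set 'I_n} := wset w (init n k).
(** Recorded by labels rather than by positions: an ascent then adds exactly the label pair of the
    tile crossed by the path. *)
Definition inversions n (w : 'S_n) : {set 'I_n * 'I_n} :=
  [set p : 'I_n * 'I_n | (p.1 < p.2)%N && (w^-1%g p.2 < w^-1%g p.1)%N].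

Section Permutations.
Variable n : nat.
Implicit Types (w v : 'S_n) (b c : 'I_n.-1) (x y s t : 'I_n) (i j : word n).

Lemma wmulE w v x : wmul w v x = w (v x).
Proof. exact: permM. Qed.

Lemma wmulA w v u : wmul w (wmul v u) = wmul (wmul w v) u.
Proof. exact/esym/mulgA. Qed.

Lemma sigmaE c x :
  sigma c x = (if nat_of_ord x == c then c.+1 else if nat_of_ord x == c.+1 then c : nat else x) :> nat.
Proof.
rewrite /sigma; case: tpermP => [->|->|/eqP + /eqP]; rewrite /= ?eqxx//.
  by rewrite gtn_eqF.
by rewrite -!val_eqE /= => /negPf-> /negPf->.
Qed.

Lemma sigma_cases c x :
  (nat_of_ord x = c /\ sigma c x = c.+1 :> nat) \/
  (nat_of_ord x = c.+1 /\ sigma c x = c :> nat) \/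
  (nat_of_ord x <> c /\ nat_of_ord x <> c.+1 /\ sigma c x = x :> nat).
Proof.
rewrite sigmaE; case: eqP => [xc|xc]; first by left.
by case: eqP => xc'; right; [left|right].
Qed.

Lemma inv_wmul_sigma w c x : (wmul w (sigma c))^-1%g x = sigma c (w^-1%g x).
Proof. by rewrite /wmul invMg permM tpermV. Qed.

Lemma sigma_comm b c : b != c -> ~~ adjacent b c ->
  wmul (sigma b) (sigma c) = wmul (sigma c) (sigma b).
Proof.
rewrite /adjacent -val_eqE /= => bc abc; apply/permP => x; apply/val_inj.
rewrite !wmulE /=.
have := sigma_cases b (sigma c x); have := sigma_cases c x.
have := sigma_cases c (sigma b x); have := sigma_cases b x.
move: bc abc; do 4!move: (nat_of_ord (sigma _ _)) => ?.
by move: (nat_of_ord x) (nat_of_ord b) (nat_of_ord c) => *; lia.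
Qed.

Lemma sigma_braid b c : adjacent b c ->
  wmul (wmul (sigma b) (sigma c)) (sigma b) = wmul (wmul (sigma c) (sigma b)) (sigma c).
Proof.
wlog bc : b c / b.+1 = c.
  by move=> h /orP[] /eqP bc; [|apply/esym]; apply: h => //; rewrite /adjacent bc eqxx ?orbT.
move=> _; have J a d : wmul (wmul (sigma a) (sigma d)) (sigma a)
    = tperm (sigma a (lo d)) (sigma a (hi d)).
  by rewrite -tpermJ /conjg /wmul tpermV mulgA.
have hb : hi b = lo c by apply/val_inj.
by rewrite !J /sigma hb tpermR tpermL !tpermD// -val_eqE /= -?bc; lia.
Qed.

Lemma in_pre w k x : (x \in pre w k) = (w^-1%g x < k)%N.
Proof.
by rewrite /pre /wset -{1}(permKV w x) mem_imset ?inE//; apply: perm_inj.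
Qed.

Lemma pre_sigma w c k : k != c.+1 -> pre (wmul w (sigma c)) k = pre w k.
Proof.
move=> kc; apply/setP => x; rewrite !in_pre inv_wmul_sigma sigmaE.
by case: eqP => [|_]; [|case: eqP]; lia.
Qed.

Lemma perm_inv_eq w x y : (w^-1%g x == y) = (x == w y).
Proof. by rewrite -(inj_eq (@perm_inj _ w)) permKV. Qed.

Lemma preS w x : pre w x.+1 = w x |: pre w x.
Proof.
apply/setP => y; rewrite !inE !in_pre ltnS leq_eqVlt; congr (_ || _).
by rewrite val_eqE perm_inv_eq.
Qed.

Lemma pre_sigma_c w c : pre (wmul w (sigma c)) c.+1 = w (hi c) |: pre w c.
Proof. by rewrite (preS _ (lo c)) wmulE tpermL pre_sigma ?ltn_eqF. Qed.

Lemma preS_lo w c : pre w c.+1 = w (lo c) |: pre w c.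
Proof. exact: (preS w (lo c)). Qed.

Lemma preS_hi w c : pre w c.+2 = w (hi c) |: (w (lo c) |: pre w c).
Proof. by rewrite (preS w (hi c)) preS_lo. Qed.

Lemma pre0 w : pre w 0 = set0.
Proof. by apply/setP => x; rewrite in_pre inE. Qed.

Lemma preT w k : (n <= k)%N -> pre w k = setT.
Proof. by move=> nk; apply/setP => x; rewrite in_pre inE; apply: leq_trans nk. Qed.

Lemma notin_pre w x : w x \notin pre w x.
Proof. by rewrite in_pre permK ltnn. Qed.

Lemma inversionsE w s t : ((s, t) \in inversions w) = (s < t)%N && (w^-1%g t < w^-1%g s)%N.
Proof. by rewrite inE. Qed.

Lemma inversions_up w c : (w (lo c) < w (hi c))%N ->
  inversions (wmul w (sigma c)) = (w (lo c), w (hi c)) |: inversions w.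
Proof.
move=> up; apply/setP => -[s t]; rewrite in_setU1 !inversionsE !inv_wmul_sigma xpair_eqE.
have := sigma_cases c (w^-1%g s); have := sigma_cases c (w^-1%g t).
rewrite -!perm_inv_eq -!val_eqE /=.
have : (w^-1%g s == lo c) ==> (s == w (lo c)) by rewrite perm_inv_eq implybb.
have : (w^-1%g s == hi c) ==> (s == w (hi c)) by rewrite perm_inv_eq implybb.
have : (w^-1%g t == lo c) ==> (t == w (lo c)) by rewrite perm_inv_eq implybb.
have : (w^-1%g t == hi c) ==> (t == w (hi c)) by rewrite perm_inv_eq implybb.
rewrite -!val_eqE /=.
do 2!move: (nat_of_ord (sigma _ _)) => ?.
by move: up; do 4!move: (nat_of_ord (fun_of_perm _ _)) => ?; lia.
Qed.

Lemma inversions_down w c : (w (hi c) < w (lo c))%N ->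
  inversions (wmul w (sigma c)) \subset inversions w.
Proof.
move=> dn; apply/subsetP => -[s t]; rewrite !inversionsE !inv_wmul_sigma.
have := sigma_cases c (w^-1%g s); have := sigma_cases c (w^-1%g t).
have : (w^-1%g s == lo c) ==> (s == w (lo c)) by rewrite perm_inv_eq implybb.
have : (w^-1%g t == hi c) ==> (t == w (hi c)) by rewrite perm_inv_eq implybb.
rewrite -!val_eqE /=.
do 2!move: (nat_of_ord (sigma _ _)) => ?.
by move: dn; do 4!move: (nat_of_ord (fun_of_perm _ _)) => ?; lia.
Qed.

Lemma notin_inversions_up w c : (w (lo c), w (hi c)) \notin inversions w.
Proof. by rewrite inversionsE !permK /= negb_and orbC -leqNgt leqnSn. Qed.

Lemma card_inversions_up w c : (w (lo c) < w (hi c))%N ->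
  #|inversions (wmul w (sigma c))| = #|inversions w|.+1.
Proof. by move=> up; rewrite inversions_up// cardsU1 notin_inversions_up. Qed.

Lemma lo_hi_neq w c : w (lo c) != w (hi c).
Proof. by rewrite (inj_eq (@perm_inj _ w)) -val_eqE /= ltn_eqF. Qed.

Fixpoint ascending w i : bool :=
  if i is c :: i' then (w (lo c) < w (hi c))%N && ascending (wmul w (sigma c)) i'
  else true.

Lemma ascending_cat w i j :
  ascending w (i ++ j) = ascending w i && ascending (wmul w (word_prod i)) j.
Proof.
elim: i w => [|c i IH] w /=; first by rewrite /wmul mul1g.
by rewrite IH andbA wmulA.
Qed.

Lemma word_prod_cat i j : word_prod (i ++ j) = wmul (word_prod i) (word_prod j).
Proof.
elim: i => [|c i IH] /=; first by rewrite /wmul mulg1.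
by rewrite -/(word_prod _) IH wmulA.
Qed.

Lemma card_inversions_word w i :
  (#|inversions (wmul w (word_prod i))| <= #|inversions w| + size i)%N.
Proof.
elim: i w => [|c i IH] w /=; first by rewrite /wmul mul1g addn0.
rewrite wmulA; apply: leq_trans (IH _) _; rewrite addnS -addSn leq_add2r.
have := lo_hi_neq w c; rewrite -val_eqE neq_ltn => /orP[up|dn].
  by rewrite card_inversions_up.
by apply: leqW; rewrite subset_leq_card ?inversions_down.
Qed.

(** A letter raises the number of inversions by at most one, so a word that gains as many inversions
    as it has letters never descends. *)
Lemma ascending_of_card w i :
  (#|inversions w| + size i <= #|inversions (wmul w (word_prod i))|)%N -> ascending w i.
Proof.
elim: i w => [//|c i IH] w /=; rewrite wmulA => h.
have := lo_hi_neq w c; rewrite -val_eqE neq_ltn => /orP[up|dn].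
  by rewrite up IH// card_inversions_up// addSn -addnS.
have := leq_trans h (card_inversions_word (wmul w (sigma c)) i).
have := subset_leq_card (inversions_down dn).
by rewrite addnS -(leq_add2r (size i)) => le /leq_trans/(_ le); rewrite ltnn.
Qed.

Lemma inversions1 : inversions 1%g = set0 :> {set 'I_n * 'I_n}.
Proof. by apply/setP => -[s t]; rewrite inversionsE in_set0 invg1 !perm1 /=; case: ltngtP. Qed.

Lemma w0E x : w0 n x = rev_ord x.
Proof. exact: permE. Qed.

Lemma w0V : (w0 n)^-1%g = w0 n.
Proof.
apply: (mulIg (w0 n)); rewrite mulVg; apply/permP => x.
by rewrite permM !w0E rev_ordK perm1.
Qed.

Lemma inversions_w0 : inversions (w0 n) = [set p : 'I_n * 'I_n | (p.1 < p.2)%N].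
Proof.
apply/setP => -[s t]; rewrite !inE /= w0V !w0E /=.
have := ltn_ord s; have := ltn_ord t; lia.
Qed.

Lemma card_ltn_pairs : #|[set p : 'I_n * 'I_n | (p.1 < p.2)%N]| = (n * n.-1)./2.
Proof.
rewrite -bin2 -bin2_sum big_mkord -sum1_card.
transitivity (\sum_(s < n) \sum_(t < n | (s < t)%N) 1)%N.
  by rewrite pair_big_dep /=; apply: eq_bigl => p; rewrite inE.
rewrite (exchange_big_dep predT)//=; apply: eq_bigr => t _.
by rewrite -(big_ord_widen n (fun=> 1%N)) ?sum_nat_const ?card_ord ?muln1 // ltnW.
Qed.

Lemma reduced_ascending i : reduced_word i -> ascending 1%g i.
Proof.
move=> [si pi]; apply: ascending_of_card.
by rewrite inversions1 cards0 add0n si {1}/wmul mulg1 pi inversions_w0 card_ltn_pairs.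
Qed.

(* The inclusion of inversion sets is the weak order. *)
Lemma inversions_sub_step w v : inversions w \subset inversions v -> w != v ->
  exists c, (w (lo c) < w (hi c))%N /\ inversions (wmul w (sigma c)) \subset inversions v.
Proof.
move=> /subsetP wv nwv.
have [c /andP[up cv]|noc] := pickP [pred c | (w (lo c) < w (hi c))%N && ((w (lo c), w (hi c)) \in inversions v)].
  exists c; split=> //; rewrite inversions_up// subUset sub1set cv.
  exact/subsetP.
(* Otherwise v^-1 w increases between any two adjacent positions: at an ascent of w by [noc], at a
   descent by the inclusion. An increasing permutation is the identity. *)
case/eqP: nwv; pose f k : 'I_n := v^-1%g (w k).
have step (c : 'I_n.-1) : (f (lo c) < f (hi c))%N.
  have := lo_hi_neq w c; rewrite -val_eqE neq_ltn => /orP[up|dn].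
    move: (noc c); rewrite /= up inversionsE up /= => /negbT.
    rewrite -leqNgt leq_eqVlt val_eqE => /orP[/eqP/perm_inj/eqP|//].
    by rewrite (negPf (lo_hi_neq w c)).
  by have := wv (w (hi c), w (lo c)); rewrite !inversionsE dn !permK /= ltnSn => /(_ isT).
have mono k : forall y : 'I_n, y = k :> nat -> (k <= f y)%N.
  elim: k => [//|k IH] y yk.
  have kn : (k < n.-1)%N by have := ltn_ord y; lia.
  have -> : y = hi (Ordinal kn) by apply/val_inj.
  exact: leq_ltn_trans (IH (lo (Ordinal kn)) erefl) (step (Ordinal kn)).
have mono' k : forall y : 'I_n, (n - y.+1)%N = k -> (f y <= y)%N.
  elim: k => [|k IH] y yk.
    by have := ltn_ord y; have := ltn_ord (f y); lia.
  have kn : (y < n.-1)%N by have := ltn_ord y; lia.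
  have -> : y = lo (Ordinal kn) by apply/val_inj.
  have := IH (hi (Ordinal kn)); have := step (Ordinal kn); rewrite /=; lia.
apply/permP => x; have fx : f x = x.
  by apply/val_inj/eqP; rewrite eqn_leq (mono' _ _ erefl) (mono _ _ erefl).
by rewrite -{2}fx /f permKV.
Qed.

End Permutations.

(** * BZ-data and their polytopes *)

Section Listing.
Variable n : nat.
Implicit Types (w v : 'S_n) (c : 'I_n.-1) (s t u x : 'I_n) (A B S : {set 'I_n}).

Lemma perm_of_seq (l : seq 'I_n) : uniq l ->
  exists w, forall (k x0 : 'I_n), (k < size l)%N -> w k = nth x0 l k.
Proof.
move=> ul; pose m := l ++ [seq x <- enum 'I_n | x \notin l].
have um : uniq m.
  rewrite cat_uniq ul filter_uniq ?enum_uniq// andbT -all_predC.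
  by apply/allP => x; rewrite mem_filter => /andP[].
have sm : size m = n.
  rewrite -[RHS](size_enum_ord n); apply/perm_size/uniq_perm => //.
    exact: enum_uniq.
  by move=> x; rewrite mem_cat mem_filter mem_enum andbT orbN.
have fi : injective (fun k : 'I_n => nth k m k).
  move=> k k' E; apply/val_inj/eqP; have mn (j : 'I_n) : (j < size m)%N by rewrite sm.
  by rewrite -(nth_uniq k (mn k) (mn k') um) E; apply/eqP/set_nth_default; rewrite sm.
exists (perm fi) => k x0 kl; rewrite permE nth_cat kl.
exact: set_nth_default.
Qed.

Lemma pre_of_seq w (l : seq 'I_n) k : uniq l -> (k <= size l)%N ->
  (forall k x0 : 'I_n, (k < size l)%N -> w k = nth x0 l k) ->
  pre w k = [set x in take k l].
Proof.
move=> ul kl wl; apply/setP => x; rewrite in_pre inE; apply/idP/idP => [xk|].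
  have xl : (w^-1%g x < size l)%N by apply: leq_trans kl.
  by rewrite -[x in x \in _](permKV w) (wl _ x)// -(nth_take x xk) mem_nth// size_takel.
move=> xk; have ix : (index x l < k)%N by rewrite -in_take // (mem_take xk).
have xl : x \in l := mem_take xk.
have ixn : (index x l < n)%N.
  apply: leq_trans (_ : size l <= n)%N; first by rewrite index_mem.
  by rewrite -[n in (_ <= n)%N]card_ord -(card_uniqP ul) max_card.
have -> : x = w (Ordinal ixn) by rewrite (wl _ x) /= ?index_mem// nth_index.
by rewrite permK.
Qed.

Lemma exists_pre A : exists w, pre w #|A| = A.
Proof.
have [w wl] := perm_of_seq (enum_uniq (mem A)).
exists w; rewrite (pre_of_seq _ _ wl) ?enum_uniq// -?cardE// cardE take_size.
by apply/setP => x; rewrite inE mem_enum.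
Qed.

(** Conditions (ii) and (iii) are indexed by permutations; listing [A] first and then the chosen
    labels turns them into statements about sets. *)
Lemma exists_step A s t : s \notin A -> t \notin A -> s != t ->
  exists w c, [/\ pre w c = A, w (lo c) = s & w (hi c) = t].
Proof.
move=> sA tA st; pose l := enum A ++ [:: s; t].
have ul : uniq l by rewrite cat_uniq enum_uniq /= !mem_enum inE (negPf sA) (negPf tA) st.
have sl : size l = #|A|.+2 by rewrite size_cat -cardE addn2.
have ln : (size l <= n)%N by rewrite -[n in (_ <= n)%N]card_ord -(card_uniqP ul) max_card.
have [w wl] := perm_of_seq ul; rewrite sl in ln.
have cn : (#|A| < n.-1)%N by lia.
exists w, (Ordinal cn); split.
- rewrite (pre_of_seq ul _ wl) ?sl//= ?leqW//.
  by rewrite cardE take_size_cat//; apply/setP => x; rewrite inE mem_enum.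
- rewrite (wl _ s) /=; last by rewrite sl !ltnS ?leqW.
  by rewrite /l nth_cat -cardE ltnn subnn.
- rewrite (wl _ s) /=; last by rewrite sl !ltnS ?leqW.
  by rewrite /l nth_cat -cardE ltnNge leqnSn /= subSnn.
Qed.

Lemma exists_step2 A s t u : s \notin A -> t \notin A -> u \notin A ->
  (s < t)%N -> (t < u)%N ->
  exists w c (d : 'I_n.-1), [/\ d = c.+1 :> nat, pre w c = A, w (lo c) = s, w (hi c) = t & w (hi d) = u].
Proof.
move=> sA tA uA st tu; pose l := enum A ++ [:: s; t; u].
have ul : uniq l.
  rewrite cat_uniq enum_uniq /= !mem_enum !inE (negPf sA) (negPf tA) (negPf uA) /=.
  by rewrite -!val_eqE /= negb_or !neq_ltn st tu (ltn_trans st tu).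
have sl : size l = #|A|.+3 by rewrite size_cat -cardE addn3.
have ln : (size l <= n)%N by rewrite -[n in (_ <= n)%N]card_ord -(card_uniqP ul) max_card.
have [w wl] := perm_of_seq ul; rewrite sl in ln.
have cn : (#|A| < n.-1)%N by lia.
have dn : (#|A|.+1 < n.-1)%N by lia.
exists w, (Ordinal cn), (Ordinal dn); split=> //.
- rewrite (pre_of_seq ul _ wl) ?sl//= ?leqW//.
  by rewrite cardE take_size_cat//; apply/setP => x; rewrite inE mem_enum.
- rewrite (wl _ s) /=; last by rewrite sl !ltnS ?leqW.
  by rewrite /l nth_cat -cardE ltnn subnn.
- rewrite (wl _ s) /=; last by rewrite sl !ltnS ?leqW.
  by rewrite /l nth_cat -cardE ltnNge leqnSn /= subSnn.
- rewrite (wl _ s) /=; last by rewrite sl !ltnS ?leqW.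
  by rewrite /l nth_cat -cardE ltnNge leqW//= -addn2 addnC addnK.
Qed.

Lemma wlengthE w : wlength w = #|inversions w|.
Proof.
pose f (p : 'I_n * 'I_n) := (w p.2, w p.1).
have fi : injective f by move=> [x y] [x' y'] [/perm_inj -> /perm_inj ->].
rewrite /wlength -(card_imset _ fi); apply: eq_card => -[s t].
rewrite inversionsE; have -> : (s, t) = f (w^-1%g t, w^-1%g s) by rewrite /f /= !permKV.
by rewrite mem_imset // inE /= !permKV andbC.
Qed.

Lemma ascent_up w c : (w (lo c) < w (hi c))%N -> ascent w c.
Proof. by move=> up; rewrite /ascent !wlengthE card_inversions_up. Qed.

End Listing.

(** * Supermodularity of BZ-data and vertices of their polytopes *)

Section BZ.
Variables (n : nat) (z : {set 'I_n} -> int).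
Hypothesis hz : BZ_datum z.
Implicit Types (w v : 'S_n) (c : 'I_n.-1) (s t u x : 'I_n) (A B S : {set 'I_n}).

Lemma BZ_set0 : z set0 = 0. Proof. by case: hz => -[]. Qed.
Lemma BZ_setT : z [set: 'I_n] = 0. Proof. by case: hz => -[]. Qed.

Lemma pairing_simple (b c : 'I_n.-1) : b != c ->
  pairing (simple_root int c) (simple_root int b) = - ((b.+1 == c :> nat)%:R + (b == c.+1 :> nat)%:R).
Proof.
move=> bc; have epsE (s k : 'I_n) : eps int s 0 k = (k == s)%:R by rewrite mxE eqxx.
rewrite /pairing /simple_root /root_vec.
under eq_bigr do rewrite !mxE !eqxx /=.
have sumd (s : 'I_n) (f : 'I_n -> int) : \sum_k (k == s)%:R * f k = f s.
  by rewrite (bigD1 s)//= eqxx mul1r big1 ?addr0// => k /negPf->; rewrite mul0r.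
under eq_bigr do rewrite mulrBl.
rewrite sumrB !sumd -!val_eqE /=; move: bc; rewrite -val_eqE /=.
by move: (nat_of_ord b) (nat_of_ord c) => {}b {}c; lia.
Qed.

Lemma sum_delta_ord m (k : nat) (F : nat -> int) : (m <= k -> F k = 0)%N ->
  \sum_(b < m) (b == k :> nat)%:R * F b = F k.
Proof.
move=> Fk; have [km|mk] := ltnP k m.
  rewrite (bigD1 (Ordinal km))//= eqxx mul1r big1 ?addr0// => b.
  by rewrite -val_eqE /= => /negPf->; rewrite mul0r.
rewrite Fk// big1// => b _; case: eqP => [bk|_]; last by rewrite mul0r.
by have := ltn_ord b; rewrite bk ltnNge mk.
Qed.

(** This is (ii): the Cartan integers keep only the neighbours of [c], whose sets are [A] and [A]
    with both labels added. When [c] is at an end of the range, the missing neighbour corresponds to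
    the empty or the full set, where z is 0. *)
Lemma BZ_edge A s t : s \notin A -> t \notin A -> s != t ->
  z (s |: A) + z (t |: A) <= z A + z (t |: (s |: A)).
Proof.
move=> sA tA st; have [w [c [<- <- <-]]] := exists_step sA tA st.
case: hz => _ _ /(_ w c) + _.
rewrite -preS_hi -preS_lo -pre_sigma_c.
rewrite -[wset w (seg c)]/(pre w c.+1) -[wset (wmul _ _) (seg c)]/(pre _ c.+1).
have -> : \sum_(b | b != c) pairing (simple_root int c) (simple_root int b) * z (wset w (seg b))
  = - \sum_(b < n.-1) (b.+1 == c :> nat)%:R * z (pre w b.+1)
    - \sum_(b < n.-1) (b == c.+1 :> nat)%:R * z (pre w b.+1).
  rewrite -opprD -big_split -sumrN [RHS](bigD1 c)//= -[LHS]add0r; congr (_ + _).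
    by rewrite (gtn_eqF (ltnSn c)) (ltn_eqF (ltnSn c)) !mul0r addr0 oppr0.
  by apply: eq_bigr => b bc; rewrite pairing_simple// mulNr mulrDl.
rewrite (@sum_delta_ord _ c.+1 (fun b => z (pre w b.+1))); last first.
  by move=> nc; rewrite preT ?BZ_setT//; lia.
have -> : \sum_(b < n.-1) (b.+1 == c :> nat)%:R * z (pre w b.+1) = z (pre w c).
  case: (posnP c) => [c0|c0].
    by rewrite big1 ?c0 ?pre0 ?BZ_set0// => b _; rewrite mul0r.
  transitivity (\sum_(b < n.-1) (b == c.-1 :> nat)%:R * z (pre w b.+1)).
    by apply: eq_bigr => b _; congr ((nat_of_bool _)%:R * _); apply/eqP/eqP; lia.
  rewrite (@sum_delta_ord _ c.-1 (fun b => z (pre w b.+1))) ?prednK//.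
  by have := ltn_ord c; lia.
lia.
Qed.

(** Supermodularity: the elements of [B] outside [A] are inserted one at a time, each insertion
    being an instance of [BZ_edge]. *)
Lemma BZ_incr A B s : A \subset B -> s \notin B ->
  z (s |: A) - z A <= z (s |: B) - z B.
Proof.
have [m] := ubnP #|B :\: A|; elim: m A => // m IH A lm AB sB.
have [AeB|nAB] := eqVneq A B; first by rewrite AeB.
have /subsetPn[t tB tA] : ~~ (B \subset A) by apply: contra nAB => BA; rewrite eqEsubset AB.
have sA : s \notin A by apply: contra sB; apply/subsetP.
have ts : t != s by apply: contraNneq sB => <-.
have /IH : (#|B :\: (t |: A)| < m)%N.
  apply: leq_trans (proper_card _) lm; apply/properP.
  by split; [exact/setDS/subsetUr|exists t; rewrite !inE ?eqxx ?tA ?tB].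
rewrite subUset sub1set tB => /(_ AB sB); have := BZ_edge tA sA ts.
by do ![move: (z _) => ?]; lia.
Qed.

Definition gain w (k : nat) : int := z (pre w k.+1) - z (pre w k).

Lemma sum_gain w m : (m <= n)%N -> \sum_(k < n | (k < m)%N) gain w k = z (pre w m).
Proof.
move=> mn; rewrite -(big_ord_widen n (gain w))// -(big_mkord predT (gain w)).
by rewrite telescope_sumr// pre0 BZ_set0 subr0.
Qed.

(** Build [S] in the order of w: by supermodularity, adding an element to the part of [S] already
    listed gains at most as much as adding it to all labels already listed. *)
Lemma le_sum_gain w S : z S <= \sum_(k < n | w k \in S) gain w k.
Proof.
have -> : z S = \sum_(k < n) (z (pre w k.+1 :&: S) - z (pre w k :&: S)).
  rewrite -(big_mkord predT (fun k => z (pre w k.+1 :&: S) - z (pre w k :&: S))).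
  by rewrite telescope_sumr// preT// setTI pre0 set0I BZ_set0 subr0.
rewrite [leRHS]big_mkcond /=; apply: ler_sum => k _; rewrite /gain preS.
case: ifP => kS; last first.
  by rewrite setIUl (_ : [set w k] :&: S = set0) ?set0U ?subrr//;
     apply/setP => x; rewrite !inE; case: eqP => // ->; rewrite kS.
rewrite setIUl (setIidPl _) ?sub1set//; apply: BZ_incr; first exact: subsetIl.
exact: notin_pre.
Qed.

Lemma pairing_chamber (R : realType) (h : 'rV[R]_n) S :
  pairing h (chamber_weight R S) = \sum_(x in S) h 0 x.
Proof.
rewrite /pairing [RHS]big_mkcond; apply: eq_bigr => x _.
rewrite /chamber_weight summxE (eq_bigr (fun s => (x == s)%:R)); last by move=> s _; rewrite mxE eqxx.
case: ifP => xS; last first.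
  by rewrite big1 ?mulr0// => s sS; case: eqP => // xs; rewrite xs sS in xS.
by rewrite (bigD1 x)//= eqxx big1 ?addr0 ?mulr1// => s /andP[_ /negPf]; rewrite eq_sym => ->.
Qed.

(* The greedy optimum for the supermodular function z: it attains the bounds of
   the sets [pre w k]. *)
Definition vertex (R : realType) w : 'rV[R]_n := \row_x (gain w (w^-1%g x))%:~R.

Lemma pairing_vertex (R : realType) w S :
  pairing (vertex R w) (chamber_weight R S) = (\sum_(k < n | w k \in S) gain w k)%:~R.
Proof.
rewrite pairing_chamber (reindex_inj (@perm_inj _ w)) rmorph_sum /=.
by apply: eq_bigr => k _; rewrite mxE permK.
Qed.

Lemma root_span_sum0 (R : realType) (h : 'rV[R]_n) :
  \sum_x h 0 x = 0 -> @root_span R n h.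
Proof.
case: (posnP n) => [n0|n0] h0.
  exists (fun=> 0); apply/rowP => -[x xn]; exfalso; by rewrite n0 in xn.
(* As the coordinates add up to 0, [h] is the combination of the differences eps_s - eps_x0 with
   coefficients h_s. *)
pose x0 := Ordinal n0; exists (fun p => if p.2 == x0 then h 0 p.1 else 0).
apply/rowP => x; rewrite summxE; apply/esym.
rewrite -(pair_bigA _ (fun s t => ((if t == x0 then h 0 s else 0) *: root_vec R s t) 0 x)) /=.
transitivity (\sum_s (h 0 s * (x == s)%:R - h 0 s * (x == x0)%:R)); last first.
  rewrite sumrB -mulr_suml h0 mul0r subr0 (bigD1 x)//= eqxx mulr1 big1 ?addr0//.
  by move=> s /negPf; rewrite eq_sym => ->; rewrite mulr0.
apply: eq_bigr => s _; rewrite (bigD1 x0)//= big1 => [|t /negPf->]; last by rewrite scale0r mxE.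
by rewrite addr0 !mxE !eqxx /= mulrBr.
Qed.

Lemma vertex_in (R : realType) w : MV_polytope R z (vertex R w).
Proof.
split; last by move=> S; rewrite pairing_vertex ler_int le_sum_gain.
apply: root_span_sum0; have := pairing_vertex R w setT.
rewrite pairing_chamber; under eq_bigl do rewrite inE.
move=> ->; apply/eqP; rewrite intr_eq0; apply/eqP.
rewrite -[RHS]BZ_setT -(preT w (leqnn n)) -sum_gain//.
by apply: eq_bigl => k; rewrite in_pre permK.
Qed.

Lemma vertex_tight (R : realType) w m : (m <= n)%N ->
  pairing (vertex R w) (chamber_weight R (pre w m)) = (z (pre w m))%:~R.
Proof.
move=> mn; rewrite pairing_vertex -sum_gain//; congr (_%:~R).
by apply: eq_bigl => k; rewrite in_pre permK.
Qed.

Lemma BZ_pluecker A s t u : s \notin A -> t \notin A -> u \notin A ->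
  (s < t)%N -> (t < u)%N ->
  z (t |: A) + z (s |: (u |: A))
  = Num.min (z (s |: A) + z (t |: (u |: A))) (z (u |: A) + z (s |: (t |: A))).
Proof.
move=> sA tA uA st tu.
have [w [c [d [dc wA ws wt wu]]]] := exists_step2 sA tA uA st tu.
have hilo : hi c = lo d by apply/val_inj; rewrite /= dc.
case: hz => _ _ _ /(_ w c d); rewrite /adjacent dc eqxx /= => /(_ isT).
move=> /(_ (ascent_up _) (ascent_up _)).
rewrite ws wt wu -hilo wt => /(_ st tu).
do 6![rewrite -[wset _ (seg _)]/(pre _ _)].
have wd : pre w d = s |: A by rewrite dc preS_lo ws wA.
have -> : pre (wmul w (sigma c)) c.+1 = t |: A by rewrite pre_sigma_c wt wA.
have -> : pre (wmul w (sigma d)) d.+1 = s |: (u |: A) by rewrite pre_sigma_c wu wd setUCA.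
have -> : pre w c.+1 = s |: A by rewrite -dc.
have -> : pre w d.+1 = s |: (t |: A) by rewrite preS_lo -hilo wt wd setUCA.
have -> : pre (wmul (wmul w (sigma c)) (sigma d)) d.+1 = t |: (u |: A).
  rewrite pre_sigma_c {1}dc pre_sigma_c wt wA wmulE /sigma tpermD ?wu 1?setUCA//;
    by rewrite -val_eqE /= dc; lia.
have -> : pre (wmul (wmul w (sigma d)) (sigma c)) c.+1 = u |: A.
  by rewrite pre_sigma_c wmulE hilo tpermL wu !pre_sigma ?wA// dc; lia.
by rewrite (addrC (z (s |: (t |: A)))).
Qed.
End BZ.

(** The vertex of a permutation listing [S] first attains the bound of the first datum at [S]; lying
    in the other polytope as well, it bounds the second datum by the first, and the roles can be
    exchanged. *)
Lemma MV_polytope_inj (R : realType) n (z z' : {set 'I_n} -> int) :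
  BZ_datum z -> BZ_datum z' -> MV_polytope R z = MV_polytope R z' -> z = z'.
Proof.
have le z1 z2 : BZ_datum z1 -> MV_polytope R z1 = MV_polytope R z2 -> forall S, z2 S <= z1 S.
  move=> h1 E S; have [w wS] := exists_pre S.
  have := vertex_in h1 R w; rewrite E => -[_ /(_ S)].
  rewrite -{2}wS vertex_tight ?wS ?ler_int//.
  by rewrite -[n in (_ <= n)%N]card_ord max_card.
by move=> hz hz' E; apply/funext => S; apply/eqP; rewrite eq_le (le _ z z')// (le _ z' z).
Qed.

(** * Rhombi and edges of a geometric tiling *)

Definition left_edges n (T : tile n) : {set edge n} :=
  [set (uvert T, tmin T); (lvert T, tmax T)].
Definition right_edges n (T : tile n) : {set edge n} :=
  [set (uvert T, tmax T); (rvert T, tmin T)].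

Lemma tile_ext n (T T' : tile n) :
  tmin T = tmin T' -> tmax T = tmax T' -> uvert T = uvert T' -> T = T'.
Proof. by case: T T' => [[? ?] ?] [[? ?] ?]; rewrite /tmin /tmax /uvert /= => -> -> ->. Qed.

Section Geometry.
Variables (R : realType) (n : nat).
Implicit Types (c : 'I_n -> R) (s t p q : 'I_n) (T : tile n) (A : {set 'I_n}).
Local Notation angle := (@side_angle R n).

Lemma side_angle_decr s t : (s < t)%N -> angle t < angle s.
Proof.
move=> st; rewrite /side_angle ltrD2l ltrN2 ltr_pM2r; last first.
  by rewrite invr_gt0 ltr0n double_gt0 (leq_ltn_trans _ (ltn_ord s)).
by rewrite ltr_pM2r ?pi_gt0// ltr_nat !ltnS ltn_double.
Qed.

Lemma side_angle_bounds s : 0 < angle s < pi.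
Proof.
have n0 : (0 < n.*2)%N by rewrite double_gt0 (leq_ltn_trans _ (ltn_ord s)).
have n0R : 0 < (n.*2)%:R :> R by rewrite ltr0n.
rewrite /side_angle; apply/andP; split; last first.
  by rewrite gtrDl oppr_lt0 divr_gt0// mulr_gt0 ?pi_gt0// ltr0n.
rewrite subr_gt0 ltr_pdivrMr// mulrC ltr_pM2l ?pi_gt0// ltr_nat.
by rewrite ltn_Sdouble.
Qed.

Lemma sin_side_angle_gt0 s : 0 < sin (angle s).
Proof. by apply: sin_gt0_pi; apply: side_angle_bounds. Qed.

Lemma sin_side_angleB_gt0 s t : (s < t)%N -> 0 < sin (angle s - angle t).
Proof.
move=> st; apply: sin_gt0_pi.
have /andP[s0 s1] := side_angle_bounds s; have /andP[t0 t1] := side_angle_bounds t.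
have := side_angle_decr st; lra.
Qed.

(* For [s < t] the horizontal unit vector is a positive combination of the
   edge vector of label t and of the opposite of that of label s; [slide]
   moves a point of the plane along it by changing only these two coordinates
   of a lift. *)
Definition slide_down s t : R := sin (angle t) / sin (angle s - angle t).
Definition slide_up s t : R := sin (angle s) / sin (angle s - angle t).
Definition slide s t (e : R) c : 'I_n -> R :=
  fun k => c k + - (e * slide_down s t) * (k == s)%:R
               + e * slide_up s t * (k == t)%:R.

Lemma slide_down_gt0 s t : (s < t)%N -> 0 < slide_down s t.
Proof. by move=> st; rewrite divr_gt0 ?sin_side_angle_gt0 ?sin_side_angleB_gt0. Qed.

Lemma slide_up_gt0 s t : (s < t)%N -> 0 < slide_up s t.
Proof. by move=> st; rewrite divr_gt0 ?sin_side_angle_gt0 ?sin_side_angleB_gt0. Qed.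

Lemma sum_perturb c s t (x y : R) (f : 'I_n -> R) :
  \sum_k (c k + x * (k == s)%:R + y * (k == t)%:R) * f k
  = \sum_k c k * f k + x * f s + y * f t.
Proof.
have sumd u (a : R) : \sum_k a * (k == u)%:R * f k = a * f u.
  rewrite (bigD1 u)//= eqxx mulr1 big1 ?addr0// => k /negPf->.
  by rewrite mulr0 mul0r.
rewrite -(sumd s x) -(sumd t y) -!big_split/=; apply: eq_bigr => k _; by rewrite !mulrDl.
Qed.

Lemma plane_slide s t e c : (s < t)%N ->
  plane (slide s t e c) = ((plane c).1 + e, (plane c).2).
Proof.
move=> st; have D0 := sin_side_angleB_gt0 st.
rewrite /plane /slide !sum_perturb/= /slide_up /slide_down; congr pair.
  rewrite -addrA; congr (_ + _).
  transitivity (e * (sin (angle s - angle t) / sin (angle s - angle t))).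
    by rewrite {3}sinB; ring.
  by rewrite divff ?mulr1// lt0r_neq0.
by rewrite -addrA -[RHS]addr0; congr (_ + _); ring.
Qed.

Lemma slide_s s t e c : (s < t)%N -> slide s t e c s = c s - e * slide_down s t.
Proof.
by move=> st; rewrite /slide eqxx -val_eqE (ltn_eqF st) mulr1 mulr0 addr0.
Qed.

Lemma slide_t s t e c : (s < t)%N -> slide s t e c t = c t + e * slide_up s t.
Proof.
by move=> st; rewrite /slide eqxx -val_eqE (gtn_eqF st) mulr1 mulr0 addr0.
Qed.

Lemma slide_out s t e c k : k != s -> k != t -> slide s t e c k = c k.
Proof. by move=> /negPf ks /negPf kt; rewrite /slide ks kt !mulr0 !addr0. Qed.

(** For s outside [A], the lift of the midpoint of the edge labelled s above v_A, which leaves room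
    one half on both sides of the coordinate s. *)
Definition mid A s : 'I_n -> R := fun k => if k == s then 2^-1 else (k \in A)%:R.

Lemma cube_slide s t e c : (s < t)%N -> cube c ->
  0 <= slide s t e c s <= 1 -> 0 <= slide s t e c t <= 1 ->
  cube (slide s t e c).
Proof.
move=> st cc cs ct k.
have [->//|ks] := eqVneq k s; have [->//|kt] := eqVneq k t.
by rewrite slide_out.
Qed.

Lemma lift_slide T e c : tile_valid T -> tile_lift T c ->
  0 <= c (tmin T) - e * slide_down (tmin T) (tmax T) <= 1 ->
  0 <= c (tmax T) + e * slide_up (tmin T) (tmax T) <= 1 ->
  tile_lift T (slide (tmin T) (tmax T) e c).
Proof.
case/and3P=> st _ _ [cc cu] hs ht; split.
  by apply: cube_slide => //; rewrite ?slide_s ?slide_t.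
by move=> k ks kt; rewrite slide_out ?cu.
Qed.

Lemma mid_lift T e : tile_valid T -> e \in tile_edges T ->
  tile_lift T (mid e.1 e.2).
Proof.
case/and3P=> st /negPf sU /negPf tU; rewrite !inE -!orbA => eT; split.
  move=> k; rewrite /mid; case: ifP => _; first by apply/andP; split; lra.
  by case: (k \in _); rewrite ?lexx ler01.
move=> k /negPf ks /negPf kt; rewrite /mid.
by case/or4P: eT => /eqP -> /=; rewrite ?ks ?kt // !inE ?ks ?kt.
Qed.

(** On a left edge the lower label has room to decrease and the upper one to increase, as a slide to
    the right demands; on a right edge it is the reverse. *)
Lemma mid_left T e : tile_valid T -> e \in left_edges T ->
  2^-1 <= mid e.1 e.2 (tmin T) /\ mid e.1 e.2 (tmax T) <= 2^-1.
Proof.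
case/and3P=> st /negPf sU /negPf tU; rewrite !inE => /orP[] /eqP -> /=; rewrite /mid eqxx.
  by rewrite -val_eqE (gtn_eqF st) tU /=; split; lra.
by rewrite -val_eqE (ltn_eqF st) !inE eqxx /=; split; lra.
Qed.

Lemma mid_right T e : tile_valid T -> e \in right_edges T ->
  mid e.1 e.2 (tmin T) <= 2^-1 /\ 2^-1 <= mid e.1 e.2 (tmax T).
Proof.
case/and3P=> st /negPf sU /negPf tU; rewrite !inE => /orP[] /eqP -> /=; rewrite /mid eqxx.
  by rewrite -val_eqE (ltn_eqF st) sU /=; split; lra.
by rewrite -val_eqE (gtn_eqF st) !inE eqxx /=; split; lra.
Qed.

(** * Tiles around an edge or a vertex *)

Section Tiling.
Variable TT : {set tile n}.
Hypothesis tiling : is_tiling R TT.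

Lemma tiling_valid T : T \in TT -> tile_valid T.
Proof. by case: tiling => + _ _; apply. Qed.

(* Both tiles contain the point of lift [c] shifted by [e] horizontally, so
   they share a point near [c] whose two lifts must agree. *)
Lemma slide_overlap T T' c e : T \in TT -> T' \in TT -> 0 < `|e| ->
  tile_lift T c -> tile_lift T' c ->
  tile_lift T (slide (tmin T) (tmax T) e c) ->
  tile_lift T' (slide (tmin T') (tmax T') e c) -> T = T'.
Proof.
move=> TTT TTT'; rewrite normr_gt0 => e0 lT lT' sT sT'.
have /and3P[st sU tU] := tiling_valid TTT.
have /and3P[st' sU' tU'] := tiling_valid TTT'.
case: tiling => _ _ /(_ _ _ _ _ TTT TTT' sT sT').
rewrite !plane_slide// => /(_ erefl) E.
have sgE s t (st0 : (s < t)%N) k : slide s t e c k - c k = e * ((k == t)%:R * slide_up s t - (k == s)%:R * slide_down s t).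
  by rewrite /slide; ring.
(* The displacement is nonzero exactly at the two labels and differs in sign there, so it determines
   [tmin] and [tmax]. *)
have {}E k : (k == tmax T)%:R * slide_up (tmin T) (tmax T) - (k == tmin T)%:R * slide_down (tmin T) (tmax T)
   = (k == tmax T')%:R * slide_up (tmin T') (tmax T') - (k == tmin T')%:R * slide_down (tmin T') (tmax T').
  by apply: (mulfI e0); rewrite -!sgE// E.
have u0 := slide_up_gt0 st; have d0 := slide_down_gt0 st.
have u0' := slide_up_gt0 st'; have d0' := slide_down_gt0 st'.
have tt' : tmax T = tmax T'.
  apply/eqP; move: (E (tmax T)); rewrite eqxx -val_eqE/= (gtn_eqF st) mul1r mul0r subr0.
  by case: eqP => //= _; case: eqP => _ /=; lra.
have ss' : tmin T = tmin T'.
  apply/eqP; move: (E (tmin T)); rewrite eqxx -val_eqE/= (ltn_eqF st) mul1r mul0r sub0r.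
  by case: (tmin T =P tmin T') => //= _; case: eqP => _ /=; lra.
have uu' : uvert T = uvert T'.
  apply/setP => k; have [->|ks] := eqVneq k (tmin T).
    by rewrite (negPf sU) ss' (negPf sU').
  have [->|kt] := eqVneq k (tmax T); first by rewrite (negPf tU) tt' (negPf tU').
  apply/idP/idP => kU; have := lT.2 k ks kt;
    rewrite lT'.2 -?ss' -?tt'// kU; case: (_ \in _) => // /eqP;
    by rewrite ?oner_eq0 // eq_sym oner_eq0.
exact: tile_ext.
Qed.

Lemma small_shift (x1 x2 x3 x4 : R) : 0 < x1 -> 0 < x2 -> 0 < x3 -> 0 < x4 ->
  exists2 e, 0 < e & [/\ 0 <= e * x1 <= 2^-1, 0 <= e * x2 <= 2^-1,
                        0 <= e * x3 <= 2^-1 & 0 <= e * x4 <= 2^-1].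
Proof.
move=> x10 x20 x30 x40; exists (2 * (x1 + x2 + x3 + x4))^-1.
  by rewrite invr_gt0; lra.
by split; rewrite mulrC ler_pdivrMr ?divr_ge0//; lra.
Qed.

Lemma forward_unique T T' c : T \in TT -> T' \in TT ->
  tile_lift T c -> tile_lift T' c ->
  2^-1 <= c (tmin T) -> c (tmax T) <= 2^-1 ->
  2^-1 <= c (tmin T') -> c (tmax T') <= 2^-1 -> T = T'.
Proof.
move=> TTT TTT' lT lT' cs ct cs' ct'.
have vT := tiling_valid TTT; have vT' := tiling_valid TTT'.
have /and3P[st _ _] := vT; have /and3P[st' _ _] := vT'.
have [e e0 [s1 s2 s3 s4]] := small_shift (slide_down_gt0 st) (slide_up_gt0 st)
  (slide_down_gt0 st') (slide_up_gt0 st').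
have b1 := lT.1 (tmin T); have b2 := lT.1 (tmax T).
have b3 := lT'.1 (tmin T'); have b4 := lT'.1 (tmax T').
apply: (@slide_overlap T T' c e) => //; first by rewrite normr_gt0 lt0r_neq0.
- by apply: lift_slide => //; lra.
- by apply: lift_slide => //; lra.
Qed.

Lemma backward_unique T T' c : T \in TT -> T' \in TT ->
  tile_lift T c -> tile_lift T' c ->
  c (tmin T) <= 2^-1 -> 2^-1 <= c (tmax T) ->
  c (tmin T') <= 2^-1 -> 2^-1 <= c (tmax T') -> T = T'.
Proof.
move=> TTT TTT' lT lT' cs ct cs' ct'.
have vT := tiling_valid TTT; have vT' := tiling_valid TTT'.
have /and3P[st _ _] := vT; have /and3P[st' _ _] := vT'.
have [e e0 [s1 s2 s3 s4]] := small_shift (slide_down_gt0 st) (slide_up_gt0 st)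
  (slide_down_gt0 st') (slide_up_gt0 st').
have b1 := lT.1 (tmin T); have b2 := lT.1 (tmax T).
have b3 := lT'.1 (tmin T'); have b4 := lT'.1 (tmax T').
apply: (@slide_overlap T T' c (- e)) => //; first by rewrite normr_gt0 oppr_eq0 lt0r_neq0.
- by apply: lift_slide => //; rewrite mulNr; lra.
- by apply: lift_slide => //; rewrite mulNr; lra.
Qed.

Lemma left_edge_inj T T' e : T \in TT -> T' \in TT ->
  e \in left_edges T -> e \in left_edges T' -> T = T'.
Proof.
have sub T0 : e \in left_edges T0 -> e \in tile_edges T0.
  by rewrite !inE => /orP[] ->; rewrite ?orbT.
move=> TTT TTT' eT eT'.
have [? ?] := mid_left (tiling_valid TTT) eT.
have [? ?] := mid_left (tiling_valid TTT') eT'.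
by apply: (@forward_unique _ _ (mid e.1 e.2)) => //;
  apply: mid_lift; rewrite ?sub // tiling_valid.
Qed.

Lemma right_edge_inj T T' e : T \in TT -> T' \in TT ->
  e \in right_edges T -> e \in right_edges T' -> T = T'.
Proof.
have sub T0 : e \in right_edges T0 -> e \in tile_edges T0.
  by rewrite !inE => /orP[] ->; rewrite ?orbT.
move=> TTT TTT' eT eT'.
have [? ?] := mid_right (tiling_valid TTT) eT.
have [? ?] := mid_right (tiling_valid TTT') eT'.
by apply: (@backward_unique _ _ (mid e.1 e.2)) => //;
  apply: mid_lift; rewrite ?sub // tiling_valid.
Qed.

(** At its left vertex a tile has coordinate 1 at the lower label and 0 at the upper one, so it
    contains points just to the right of this vertex. *)
Lemma lvert_inj T T' : T \in TT -> T' \in TT -> lvert T = lvert T' -> T = T'.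
Proof.
move=> TTT TTT' ll'; pose c k : R := (k \in lvert T)%:R.
have vert T0 : tile_valid T0 -> lvert T0 = lvert T -> [/\ tile_lift T0 c, c (tmin T0) = 1 & c (tmax T0) = 0].
  case/and3P=> st sU tU ll; rewrite /c -ll !inE eqxx; split=> //.
    split=> [k|k /negPf ks kt]; first by case: (k \in _); rewrite ?lexx ler01.
    by rewrite !inE ks.
  by rewrite -val_eqE (gtn_eqF st) (negPf tU).
have [? c1 c2] := vert _ (tiling_valid TTT) erefl.
have [? c3 c4] := vert _ (tiling_valid TTT') (esym ll').
by apply: (@forward_unique _ _ c) => //; rewrite ?c1 ?c2 ?c3 ?c4; lra.
Qed.

Definition present (e : edge n) : bool :=
  (e \in left_boundary n) || [exists T in TT, e \in tile_edges T].

(** The linear functional normal to the edge s attains its maximum on the polygon along that edge: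
    the terms d_k sin(angle k - angle s) are all nonpositive and add up to 0, which forces every
    coordinate but s; the height then forces s. *)
Lemma left_boundary_mid s c :
  cube c -> plane c = plane (mid (init n s) s) -> c =1 mid (init n s) s.
Proof.
move=> cc [E1 E2]; set m := mid _ _ in E1 E2 *.
pose d k := c k - m k.
have S1 : \sum_k d k * cos (angle k) = 0.
  by under eq_bigr do rewrite mulrBl; rewrite sumrB E1 subrr.
have S2 : \sum_k d k * sin (angle k) = 0.
  by under eq_bigr do rewrite mulrBl; rewrite sumrB E2 subrr.
have S3 : \sum_k - (d k * sin (angle k - angle s)) = 0.
  transitivity (sin (angle s) * (\sum_k d k * cos (angle k))
                - cos (angle s) * \sum_k d k * sin (angle k)).
    by rewrite !mulr_sumr -sumrB; apply: eq_bigr => k _; rewrite sinB; ring.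
  by rewrite S1 S2; ring.
have pos k : true -> 0 <= - (d k * sin (angle k - angle s)).
  move=> _; have /andP[c0 c1] := cc k; rewrite /d /m /mid.
  case: (ltngtP k s) => [ks|sk|/val_inj->]; last by rewrite subrr sin0 mulr0 oppr0.
  - have := sin_side_angleB_gt0 ks; rewrite inE ks -val_eqE (ltn_eqF ks) /= => ?.
    by rewrite -mulNr mulr_ge0; lra.
  - have := sin_side_angleB_gt0 sk; rewrite inE ltnNge (ltnW sk) -val_eqE (gtn_eqF sk)/=.
    by rewrite -opprB sinN => ?; rewrite -mulrN mulr_ge0; lra.
have dz k : k != s -> d k = 0.
  move=> ks; move: S3 => /eqP; rewrite psumr_eq0//.
  move=> /allP/(_ k); rewrite mem_index_enum => /(_ isT) /eqP /eqP.
  rewrite oppr_eq0 mulf_eq0 => /orP[/eqP//|].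
  case: (ltngtP k s) => [kls|skl|/val_inj kE]; last by rewrite kE eqxx in ks.
  - by rewrite (gt_eqF (sin_side_angleB_gt0 kls)).
  - by rewrite -opprB sinN oppr_eq0 (gt_eqF (sin_side_angleB_gt0 skl)).
move=> k; have [->|ks] := eqVneq k s; last by apply/eqP; rewrite -subr_eq0; apply/eqP; apply: dz.
move: S2; rewrite (bigD1 s)//= big1 => [|j js]; last by rewrite dz ?mul0r.
by move=> /eqP; rewrite addr0 mulf_eq0 (gt_eqF (sin_side_angle_gt0 s)) orbF subr_eq0 => /eqP.
Qed.

Lemma present_mid T c e : present e -> T \in TT -> tile_lift T c ->
  plane c = plane (mid e.1 e.2) -> c =1 mid e.1 e.2.
Proof.
case/orP=> [/imsetP[s _ ->]|/exists_inP[T0 TT0 eT0]] TTT lT.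
  exact/left_boundary_mid/lT.1.
case: tiling => _ _ /(_ _ _ _ _ TTT TT0 lT); apply.
exact/mid_lift/eT0/tiling_valid.
Qed.

(** Off the right boundary either some t > s is missing from [A] or some r < s lies in [A]; this
    label and s form a pair that can be slid to the right inside the cube. *)
Lemma polygon_slide A s : s \notin A -> A != [set k : 'I_n | (s < k)%N] ->
  exists2 d : R, 0 < d & forall e, 0 < e -> e < d ->
    @polygon R n ((plane (mid A s)).1 + e, (plane (mid A s)).2).
Proof.
move=> sA /eqP nA.
have cm : cube (mid A s).
  by move=> k; rewrite /mid; case: ifP => _; [|case: (k \in A)] => /=; apply/andP; split; lra.
have [t tA|noB] := pickP [pred t : 'I_n | (s < t)%N && (t \notin A)].
  case/andP: tA => st /negPf tA.
  have d0 := slide_down_gt0 st; have u0 := slide_up_gt0 st.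
  (* Below this bound neither coordinate moves by more than one half, the room that the midpoint
     leaves at s. *)
  exists (2 * (slide_down s t + slide_up s t))^-1; first by rewrite invr_gt0; lra.
  move=> e e0; rewrite -[_^-1]mul1r ltr_pdivlMr; last lra.
  have := mulr_gt0 e0 d0; have := mulr_gt0 e0 u0 => e1 e2 e3.
  exists (slide s t e (mid A s)); last by rewrite plane_slide.
  apply: cube_slide => //; rewrite ?slide_s ?slide_t// /mid.
    by rewrite eqxx; apply/andP; split; lra.
  by rewrite -val_eqE (gtn_eqF st) tA /=; apply/andP; split; lra.
have [r rA|noC] := pickP [pred r : 'I_n | (r < s)%N && (r \in A)].
  case/andP: rA => st tA.
  have d0 := slide_down_gt0 st; have u0 := slide_up_gt0 st.
  exists (2 * (slide_down r s + slide_up r s))^-1; first by rewrite invr_gt0; lra.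
  move=> e e0; rewrite -[_^-1]mul1r ltr_pdivlMr; last lra.
  have := mulr_gt0 e0 d0; have := mulr_gt0 e0 u0 => e1 e2 e3.
  exists (slide r s e (mid A s)); last by rewrite plane_slide.
  apply: cube_slide => //; rewrite ?slide_s ?slide_t// /mid.
    by rewrite -val_eqE (ltn_eqF st) tA /=; apply/andP; split; lra.
  by rewrite eqxx; apply/andP; split; lra.
case: nA; apply/setP => k; rewrite inE.
case: (ltngtP s k) => [sk|ks|/val_inj <-]; last by rewrite (negPf sA).
- by have := noB k; rewrite inE sk /= => /negbFE.
- by have := noC k; rewrite inE ks.
Qed.

(** Pigeonhole: if each item of the finite list failed below a threshold of its own, none would
    serve below the least threshold. *)
Lemma accumulation (I : eqType) (l : seq I) (P : R -> I -> Prop) (d : R) :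
  0 < d -> (forall e, 0 < e -> e < d -> exists2 i, i \in l & P e i) ->
  exists2 i, i \in l & forall d', 0 < d' -> exists e, [/\ 0 < e, e < d' & P e i].
Proof.
elim: l d => [|i l IH] d d0 h.
  have d20 : 0 < d / 2 by lra.
  have d2d : d / 2 < d by lra.
  by have [j] := h _ d20 d2d; rewrite in_nil.
have [acc|nacc] := pselect (forall d', 0 < d' -> exists e, [/\ 0 < e, e < d' & P e i]).
  by exists i => //; rewrite mem_head.
move: nacc => /existsNP[d' /not_implyP[d'0 nP]].
have [|e e0|j jl hj] := IH (Num.min d d'); first by rewrite lt_min d0.
  rewrite lt_min => /andP[ed ed']; have [j] := h e e0 ed.
  by rewrite inE => /predU1P[-> Pj|jl Pj]; [case: nP; exists e|exists j].
by exists j => //; rewrite inE jl orbT.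
Qed.

(** Stands for the closedness of a rhombus, one coordinate bound at a time. *)
Lemma limit_ge0 (x y : R) :
  (forall d, 0 < d -> exists e, [/\ 0 < e, e < d & 0 <= x + e * y]) -> 0 <= x.
Proof.
move=> h; rewrite leNgt; apply/negP => x0.
have d0 : 0 < - x / (1 + `|y|) by rewrite divr_gt0 ?ltr_pwDl// oppr_gt0.
have [e [e0]] := h _ d0; rewrite ltr_pdivlMr ?ltr_pwDl// => ed.
have := ler_norm y; rewrite -(ler_pM2l e0); lra.
Qed.

Lemma plane_inj2 p q c c' : (p < q)%N ->
  (forall k, k != p -> k != q -> c k = c' k) -> plane c = plane c' -> c =1 c'.
Proof.
move=> pq cc' [E1 E2]; pose d k := c k - c' k.
have qp : q != p by rewrite -val_eqE (gtn_eqF pq).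
have S f : \sum_k c k * f k = \sum_k c' k * f k -> d p * f p + d q * f q = 0.
  move=> E; have : \sum_k d k * f k = 0.
    by under eq_bigr do rewrite mulrBl; rewrite sumrB E subrr.
  rewrite (bigD1 p)//= (bigD1 q)//= big1 ?addr0// => k /andP[kp kq].
  by rewrite /d cc'// subrr mul0r.
have {}E1 := S (fun k => cos (angle k)) E1; have {}E2 := S (fun k => sin (angle k)) E2.
have D0 := sin_side_angleB_gt0 pq.
have dp : d p = 0.
  apply/eqP; have : d p * sin (angle p - angle q) == 0; last by rewrite mulf_eq0 (gt_eqF D0) orbF.
  apply/eqP; transitivity (cos (angle q) * 0 - sin (angle q) * 0 : R); last by ring.
  by rewrite -{1}E2 -{1}E1 sinB; ring.
have dq : d q = 0.
  apply/eqP; move: E2; rewrite dp mul0r add0r => /eqP.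
  by rewrite mulf_eq0 (gt_eqF (sin_side_angle_gt0 q)) orbF.
move=> k; have [->|kp] := eqVneq k p; first exact/subr0_eq.
have [->|kq] := eqVneq k q; [exact/subr0_eq|exact: cc'].
Qed.

(** Points arbitrarily close to the midpoint on its right lie in one tile. In the limit this tile
    contains the midpoint, whose lift is unique, and the room left for sliding to the right shows
    that the edge is on its left side. *)
Lemma left_edge_exists e : present e -> e.2 \notin e.1 ->
  e.1 != [set k : 'I_n | (e.2 < k)%N] -> exists2 T, T \in TT & e \in left_edges T.
Proof.
case: e => A s /= pe sA nA; set m := mid A s.
have [d d0 hd] := polygon_slide sA nA.
have [x y xd|T TTT accT] := @accumulation _ (enum TT)
  (fun x T => rhombus T ((plane m).1 + x, (plane m).2)) d d0.
  have := hd x y xd; case: tiling => _ <- _ [T TTT ?].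
  by exists T => //; rewrite mem_enum.
exists T; first by rewrite mem_enum in TTT.
rewrite mem_enum in TTT.
have vT := tiling_valid TTT; have /and3P[pq pB qB] := vT.
set p := tmin T in pq pB; set q := tmax T in pq qB.
have d1 := slide_down_gt0 pq; have u1 := slide_up_gt0 pq.
(* Sliding one of these points back gives a lift [c] of the midpoint. One positive shift yields
   [0 < c p] and [c q < 1]; arbitrarily small ones yield [c p <= 1] and [0 <= c q]. *)
have [x0 [x00 _ [c0 lc0 pc0]]] := accT 1 ltr01.
pose c := slide p q (- x0) c0.
have pc : plane c = plane m.
  by rewrite plane_slide// pc0 addrK; case: (plane m).
have c_out k : k != p -> k != q -> c k = (k \in uvert T)%:R.
  by move=> kp kq; rewrite /c slide_out ?lc0.2.
have cE x : rhombus T ((plane m).1 + x, (plane m).2) ->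
    0 <= c p - x * slide_down p q <= 1 /\ 0 <= c q + x * slide_up p q <= 1.
  move=> [c' lc' pc'].
  have E : slide p q x c =1 c'.
    apply: (plane_inj2 pq) => [k kp kq|]; first by rewrite slide_out// c_out// lc'.2.
    by rewrite plane_slide// pc.
  by rewrite -slide_s// -slide_t// !E; split; apply: lc'.1.
have cp1 : c p <= 1.
  rewrite -subr_ge0; apply: (@limit_ge0 _ (slide_down p q)) => e e0.
  have [x [? ? /cE[/andP[? ?] _]]] := accT e e0; exists x; split=> //; lra.
have cq0 : 0 <= c q.
  apply: (@limit_ge0 _ (slide_up p q)) => e e0.
  by have [x [? ? /cE[_ /andP[? ?]]]] := accT e e0; exists x.
have [x1 [x10 _ /cE[/andP[cp _] /andP[_ cq]]]] := accT 1 ltr01.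
have cp0 : 0 < c p by have := mulr_gt0 x10 d1; lra.
have cq1 : c q < 1 by have := mulr_gt0 x10 u1; lra.
have lc : tile_lift T c.
  split=> // k; have [->|kp] := eqVneq k p; first by rewrite cp1 ltW.
  have [->|kq] := eqVneq k q; first by rewrite cq0 ltW.
  by rewrite c_out//; case: (_ \in _); rewrite ?lexx ler01.
have cm := present_mid pe TTT lc pc; rewrite /= -/m in cm.
have half (b : bool) : (2^-1 : R) <> b%:R by case: b => /= ?; lra.
have out k : k != s -> k != p -> k != q -> (k \in A) = (k \in uvert T).
  move=> ks kp kq; have := cm k; rewrite c_out// /m /mid (negPf ks).
  by do 2!case: (k \in _) => //=; lra.
rewrite !inE /lvert -/p -/q.
(* Outside p and q the coordinates are 0 or 1, so the coordinate one half is at p or q; the strict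
   bounds select the left edge in each case. *)
have [sp|sp] := eqVneq s p.
  have qs : q != s by rewrite sp -val_eqE (gtn_eqF pq).
  have qA : q \notin A.
    by move: cq1; rewrite cm /m /mid (negPf qs); case: (_ \in _) => //=; rewrite ltxx.
  suff -> : A = uvert T by rewrite sp eqxx.
  apply/setP => k; have [->|ks] := eqVneq k s; first by rewrite (negPf sA) sp (negPf pB).
  have [->|kq] := eqVneq k q; first by rewrite (negPf qA) (negPf qB).
  by rewrite out// -sp.
have [sq|sq] := eqVneq s q; last first.
  by have := cm s; rewrite c_out// /m /mid eqxx => /esym/half.
have pA : p \in A.
  have /negPf ps : p != s by rewrite eq_sym.
  by move: cp0; rewrite cm /m /mid ps; case: (_ \in _) => //=; rewrite ltxx.
suff -> : A = p |: uvert T by rewrite sq eqxx orbT.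
apply/setP => k; rewrite !inE; have [->|kp] := eqVneq k p; first by rewrite pA.
have [->|ks] := eqVneq k s; first by rewrite (negPf sA) sq (negPf qB).
by rewrite out// -sq.
Qed.
End Tiling.
End Geometry.

(** * Sweeping a tiling *)

Definition path_edges n (w : 'S_n) : {set edge n} :=
  [set (pre w k, w k) | k : 'I_n].

(* The labels that the strip of [e] still has to cross on its way to the right
   boundary. *)
Definition defect n (e : edge n) : {set 'I_n} :=
  [set k : 'I_n | (k \in e.1) != (e.2 < k)%N].

Section Edges.
Variable n : nat.
Implicit Types (w : 'S_n) (T : tile n) (e : edge n) (A : {set 'I_n}).

Lemma tile_edgesE T : tile_edges T = left_edges T :|: right_edges T.
Proof. by rewrite /tile_edges /left_edges /right_edges !setUA. Qed.

Lemma in_left_boundary A s : ((A, s) \in left_boundary n) = (A == init n s).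
Proof.
apply/imsetP/eqP => [[k _ [-> ->]]//|->]; by exists s.
Qed.

Lemma left_boundary_right_edges T e :
  tile_valid T -> e \in left_boundary n -> e \notin right_edges T.
Proof.
case: e => A s /and3P[st sU tU]; rewrite in_left_boundary !inE => /eqP ->.
apply/negP => /orP[] /eqP [E1 E2].
  by move: sU; rewrite -E1 inE E2 st.
have : tmax T \in init n s by rewrite E1 !inE eqxx.
by rewrite inE E2 ltnNge (ltnW st).
Qed.

(** The strip continues through the opposite edge. Crossing a larger label adds it to the lower set,
    crossing a smaller one removes it; either way that label leaves the defect, so strips end. *)
Lemma strip_next T e : tile_valid T -> e \in left_edges T ->
  exists2 e', e' \in right_edges T &
    [/\ e'.2 = e.2, e'.2 \notin e'.1, defect e' \proper defect e
      & (tmin T = e.2 /\ e'.1 = tmax T |: e.1) \/ e'.1 \subset e.1].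
Proof.
case: e => A s /and3P[st sU tU]; rewrite !inE => /orP[] /eqP [-> ->].
  exists (rvert T, tmin T); first by rewrite !inE eqxx orbT.
  split=> //=; last by left.
    by rewrite !inE (negPf sU) orbF -val_eqE ltn_eqF.
  apply/properP; split; last by exists (tmax T); rewrite !inE /= ?eqxx /= ?st ?(negPf tU).
  by apply/subsetP => k; rewrite !inE /=; have [->|//] := eqVneq k (tmax T); rewrite /= st.
exists (uvert T, tmax T); first by rewrite !inE eqxx.
split=> //=; last by right; apply: subsetUr.
have ts : (tmax T < tmin T)%N = false by apply/negbTE; rewrite -leqNgt ltnW.
apply/properP; split; last first.
  by exists (tmin T); rewrite !inE /= ?eqxx /= ?ts ?(negPf sU).
by apply/subsetP => k; rewrite !inE /=; have [->|//] := eqVneq k (tmin T); rewrite /= ts (negPf sU).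
Qed.

Lemma in_path_edges w A s : ((A, s) \in path_edges w) = (A == pre w (w^-1%g s)).
Proof.
apply/imsetP/eqP => [[k _ [-> ->]]|->]; first by rewrite permK.
by exists (w^-1%g s); rewrite // permKV.
Qed.

Lemma path_edges1 : path_edges 1%g = left_boundary n.
Proof.
apply/setP => -[A s]; rewrite in_path_edges in_left_boundary invg1 perm1.
by congr (_ == _); apply/setP => x; rewrite in_pre inE invg1 perm1.
Qed.

Lemma path_edges_w0 A s :
  ((A, s) \in path_edges (w0 n)) = (A == [set k : 'I_n | (s < k)%N]).
Proof.
rewrite in_path_edges; congr (_ == _); apply/setP => x.
by rewrite in_pre inE w0V !w0E /=; have := ltn_ord x; have := ltn_ord s; lia.
Qed.

Definition step_tile w (c : 'I_n.-1) : tile n := (w (lo c), w (hi c), pre w c).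

Lemma path_edges_step w c : let T := step_tile w c in
  path_edges (wmul w (sigma c)) = (path_edges w :\: left_edges T) :|: right_edges T.
Proof.
move=> T; apply/setP => -[A s]; rewrite !inE !in_path_edges inv_wmul_sigma !xpair_eqE.
rewrite /uvert /lvert /rvert /tmin /tmax /=.
have lh : w (lo c) == w (hi c) = false by apply/negbTE/lo_hi_neq.
have [->|slo] := eqVneq s (w (lo c)).
  rewrite permK /sigma tpermL pre_sigma_c lh !andbF !andbT orbF /=.
  by case: (A == pre w c) => //=.
have [->|shi] := eqVneq s (w (hi c)).
  rewrite permK /sigma tpermR pre_sigma ?ltn_eqF// preS_lo !andbF !andbT !orbF /=.
  by case: (A == w (lo c) |: pre w c).
rewrite !andbF /= orbF; congr (_ == _).
have := slo; have := shi; rewrite -!perm_inv_eq -!val_eqE /= => p1 p2.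
have -> : sigma c (w^-1%g s) = w^-1%g s.
  by apply: val_inj; have := sigma_cases c (w^-1%g s); rewrite /=; lia.
by rewrite pre_sigma.
Qed.

End Edges.

Section Sweep.
Variables (R : realType) (n : nat) (TT : {set tile n}).
Hypothesis tiling : is_tiling R TT.
Implicit Types (w : 'S_n) (T : tile n) (e : edge n) (D X : {set tile n}).

Let valid := tiling_valid tiling.
Let left_inj := left_edge_inj tiling.
Let right_inj := right_edge_inj tiling.

(* The edges on the right border of the union of the tiles of [D], if [D] is
   closed under taking left neighbours. *)
Definition frontier D : {set edge n} :=
  [set e | ((e \in left_boundary n) || [exists T in D, e \in right_edges T])
           && [forall T in D, e \notin left_edges T]].

Definition left_closed D : Prop := D \subset TT /\
  forall T T' e, T \in TT -> T' \in D ->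
    e \in right_edges T -> e \in left_edges T' -> T \in D.

Lemma frontier_right D T e : left_closed D -> T \in TT -> T \notin D ->
  e \in right_edges T -> e \notin frontier D.
Proof.
move=> [/subsetP DT _] TTT TD eT; rewrite inE negb_and negb_or; apply/orP; left.
apply/andP; split.
  by apply/negP => /(left_boundary_right_edges (valid TTT)); rewrite eT.
apply/exists_inPn => T' T'D; apply/negP => eT'.
by move: TD; rewrite (right_inj TTT (DT _ T'D) eT eT') T'D.
Qed.

Section Add.
Variables (D X : {set tile n}).
Hypotheses (cD : left_closed D) (XT : X \subset TT)
  (XD : forall T, T \in X -> T \notin D)
  (Xl : forall T, T \in X -> left_edges T \subset frontier D).

Lemma left_closed_add : left_closed (D :|: X).
Proof.
split; first by rewrite subUset XT cD.1.
move=> T T' e TTT; rewrite !(in_setU _ D) => /orP[T'D|T'X] eT eT'.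
  by rewrite (cD.2 _ _ _ TTT T'D eT eT').
have [//|TD] := boolP (T \in D).
have := frontier_right cD TTT TD eT.
by rewrite (subsetP (Xl T'X)).
Qed.

Lemma frontier_add : frontier (D :|: X) =
  (frontier D :\: \bigcup_(T in X) left_edges T) :|: \bigcup_(T in X) right_edges T.
Proof.
apply/setP => e; rewrite in_setU in_setD.
have [eR|eR] := boolP (e \in \bigcup_(T in X) right_edges T).
  rewrite orbT; have /bigcupP[T TX eT] := eR.
  have TTT := subsetP XT _ TX; have eF := frontier_right cD TTT (XD TX) eT.
  rewrite inE; apply/andP; split.
    by apply/orP; right; apply/exists_inP; exists T; rewrite // (in_setU _ D) TX orbT.
  apply/forall_inP => T'; rewrite (in_setU _ D) => /orP[T'D|T'X]; apply/negP => eT'.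
    by have := XD TX; rewrite (cD.2 _ _ _ TTT T'D eT eT').
  by have := subsetP (Xl T'X) _ eT'; rewrite (negPf eF).
rewrite orbF [e \in frontier _]inE [e \in frontier D]inE; apply/idP/idP.
  move=> /andP[h1 /forall_inP h2]; apply/and3P; split.
  - by apply/bigcupP => -[T TX]; apply/negP/h2; rewrite (in_setU _ D) TX orbT.
  - case/orP: h1 => [->//|/exists_inP[T]]; rewrite (in_setU _ D) => /orP[TD|TX] eT.
      by apply/orP; right; apply/exists_inP; exists T.
    by case/bigcupP: eR; exists T.
  - by apply/forall_inP => T TD; apply: h2; rewrite (in_setU _ D) TD.
move=> /and3P[h1 h2 /forall_inP h3]; apply/andP; split.
  case/orP: h2 => [->//|/exists_inP[T TD eT]]; apply/orP; right.
  by apply/exists_inP; exists T; rewrite // (in_setU _ D) TD.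
apply/forall_inP => T; rewrite (in_setU _ D) => /orP[/h3//|TX]; apply: contra h1 => eT.
by apply/bigcupP; exists T.
Qed.
End Add.

Lemma left_closed0 : left_closed set0.
Proof. by split=> [|T T' e _]; rewrite ?sub0set // inE. Qed.

Lemma frontier0 : frontier set0 = left_boundary n.
Proof.
apply/setP => e; rewrite inE; rewrite (_ : [forall T in set0, _]) ?andbT.
  rewrite orbC; case: exists_inP => [[T]|//]; by rewrite inE.
by apply/forall_inP => T; rewrite inE.
Qed.

(** A right edge of an unswept tile is never on the frontier, so the two edges counted in [layer_of]
    can only be the left ones. *)
Lemma layer_ofE D : left_closed D -> layer_of TT (D, frontier D) =
  [set T in TT | (T \notin D) && (left_edges T \subset frontier D)].
Proof.
move=> cD; apply/setP => T; rewrite !inE /=; apply: andb_id2l => TTT; apply: andb_id2l => TD.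
have -> : tile_edges T :&: frontier D = left_edges T :&: frontier D.
  rewrite tile_edgesE setIUl [X in _ :|: X](_ : _ = set0) ?setU0//.
  apply/setP => e; rewrite inE [RHS]inE; apply/negP => /andP[eT].
  exact/negP/(frontier_right cD TTT).
have c2 : #|left_edges T| = 2.
  have /and3P[st _ _] := valid TTT.
  by rewrite cards2 xpair_eqE [tmin T == _](_ : _ = false) ?andbF// -val_eqE ltn_eqF.
apply/idP/idP => [/eqP c|sub]; last by rewrite (setIidPl sub) c2.
by apply/setIidPl/eqP; rewrite eqEcard subsetIl c c2.
Qed.

(** The left edges of a layer lie on the path and its right edges do not, so the symmetric
    difference in [sweep] exchanges the former for the latter. *)
Lemma sweep_inv k : left_closed (sweep TT k).1 /\
  (sweep TT k).2 = frontier (sweep TT k).1.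
Proof.
elim: k => [|k [cD fD]] /=; first by split; [exact: left_closed0|rewrite frontier0].
case: (sweep TT k) cD fD => D F /= cD ->; set X := layer_of _ _.
have XE := layer_ofE cD; rewrite -/X in XE.
have XT : X \subset TT by apply/subsetP => T; rewrite XE inE => /andP[].
have XD T : T \in X -> T \notin D by rewrite XE inE => /and3P[].
have Xl T : T \in X -> left_edges T \subset frontier D by rewrite XE inE => /and3P[].
split; first exact: left_closed_add.
rewrite frontier_add//; apply/setP => e; rewrite !in_setU !in_setD.
have -> : \bigcup_(T in X) tile_edges T
   = \bigcup_(T in X) left_edges T :|: \bigcup_(T in X) right_edges T.
  by rewrite -big_split; apply: eq_bigr => T _; rewrite tile_edgesE.
rewrite in_setU.
have l : (e \in \bigcup_(T in X) left_edges T) -> e \in frontier D.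
  by move=> /bigcupP[T /Xl /subsetP]; apply.
have r : (e \in \bigcup_(T in X) right_edges T) -> e \notin frontier D.
  by move=> /bigcupP[T TX]; apply: (frontier_right cD); [apply: (subsetP XT)|apply: XD].
case: (boolP (e \in \bigcup_(T in X) right_edges T)) r => [_ /(_ isT) /negPf ->|_ _].
  by rewrite !orbT.
rewrite !orbF; move: l; case: (e \in \bigcup_(T in X) _) => //= [->//|_].
by case: (e \in frontier D).
Qed.

Lemma frontier_present D e : left_closed D -> e \in frontier D -> present TT e.
Proof.
move=> [/subsetP DT _]; rewrite inE => /andP[/orP[eB|/exists_inP[T TD eT]] _].
  by rewrite /present eB.
apply/orP; right; apply/exists_inP; exists T; first exact: DT.
by rewrite tile_edgesE in_setU eT orbT.
Qed.

(** Adding single tiles instead of layers keeps the frontier equal to the path of a permutation; its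
    inversions contain the label pairs used so far, hence no pair recurs. *)
Record swept w D : Prop := Swept {
  swept_closed : left_closed D;
  swept_frontier : frontier D = path_edges w;
  swept_inversions : forall T, T \in D -> (tmin T, tmax T) \in inversions w;
  swept_unique : forall T T', T \in D -> T' \in D ->
    tmin T = tmin T' -> tmax T = tmax T' -> T = T' }.

Lemma swept1 : swept 1%g set0.
Proof.
split; [exact: left_closed0|by rewrite frontier0 path_edges1| |];
  by move=> T; rewrite in_set0.
Qed.

(* If the tile to the right of the k-th edge of the path has this edge as its
   lower left edge, and the tile to the right of the next edge has that one as
   its upper left edge, then both tiles contain the points just to the right of
   the vertex between the two edges, so that they are equal. *)
Lemma swept_next w D : swept w D -> w != w0 n ->
  exists c, step_tile w c \in TT /\ (w (lo c) < w (hi c))%N.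
Proof.
move=> [cD fD _ _] nw0.
pose up (k : 'I_n) := [exists T in TT, (uvert T == pre w k) && (tmin T == w k)].
pose dn (k : 'I_n) := [exists T in TT, (lvert T == pre w k) && (tmax T == w k)].
pose rb (k : 'I_n) := pre w k == [set x : 'I_n | (w k < x)%N].
have updn k : ~~ rb k -> up k || dn k.
  move=> nrb; have pk : present TT (pre w k, w k).
    by apply: (frontier_present cD); rewrite fD imset_f.
  have [T TTT] := left_edge_exists tiling pk (notin_pre w k) nrb.
  rewrite !inE => /orP[] /eqP [E1 E2]; apply/orP; [left|right];
    by apply/exists_inP; exists T; rewrite // E1 E2 !eqxx.
have [k0 nrb0] : exists k, ~~ rb k.
  apply/existsP; rewrite -negb_forall; apply: contra nw0 => /forallP rbT.
  apply: contraT; rewrite eq_sym => w0w.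
  have sub : inversions (w0 n) \subset inversions w.
    apply/subsetP => -[x y]; rewrite inversions_w0 inversionsE inE /= => xy; rewrite xy.
    by rewrite -in_pre (eqP (rbT _)) inE permKV.
  by have [c [+ _]] := inversions_sub_step sub w0w; rewrite !w0E /=; lia.
(* At the lowest edge off the right boundary [dn] fails: the path below it has collected only labels
   larger than [w k], and [tmin T] would be one of them. *)
have [k1 up1] : exists k, up k.
  case: (@arg_minnP _ k0 (fun k => ~~ rb k) (fun k : 'I_n => val k) nrb0) => k nrb kmin.
  case/orP: (updn k nrb) => [|dnk]; first by exists k.
  have /exists_inP[T TTT /andP[/eqP lT /eqP tT]] := dnk.
  have /and3P[st sU tU] := valid TTT.
  have sp : tmin T \in pre w k by rewrite -lT !inE eqxx.
  have k0' : (0 < k)%N by case: (posnP k) sp => // ->; rewrite pre0 inE.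
  have kn : (k.-1 < n)%N by apply: leq_ltn_trans (leq_pred _) (ltn_ord k).
  pose k' := Ordinal kn.
  have pk : pre w k = w k' |: pre w k' by rewrite -preS /= prednK.
  have nrb' : ~~ rb k'.
    apply/negP => /eqP rk'.
    have tp := notin_pre w k; rewrite pk rk' !inE -tT negb_or in tp.
    rewrite pk rk' !inE in sp.
    have [/eqP tk' /negPf tk''] := andP tp.
    case/orP: sp => [/eqP sk|]; last by lia.
    by rewrite sk tk'' in st.
  by have := kmin _ nrb'; rewrite /= -ltnS prednK// ltnn.
case: (@arg_maxnP _ k1 up (fun k : 'I_n => val k) up1) => k upk kmax.
have /exists_inP[T TTT /andP[/eqP uT /eqP sT]] := upk.
have /and3P[st sU tU] := valid TTT.
have tp : tmax T \notin pre w k.+1.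
  by rewrite preS !inE -sT -uT (negPf tU) orbF -val_eqE gtn_eqF.
have kn : (k.+1 < n)%N.
  by rewrite ltnNge; apply: contra tp => nk; rewrite preT ?inE.
pose k' := Ordinal kn.
(* [pre w k'] contains [w k] but not the larger label [tmax T], so it is not an upper set of
   labels. *)
have nrb' : ~~ rb k'.
  apply/negP => /eqP rk'; move: tp; rewrite -[k.+1]/(val k') rk' inE.
  have : w k \in pre w k' by rewrite in_pre permK /=.
  by rewrite rk' inE -sT; lia.
have cn : (k < n.-1)%N by rewrite ltn_predRL.
have hk : hi (Ordinal cn) = k' by apply: val_inj.
have lk : lo (Ordinal cn) = k by apply: val_inj.
exists (Ordinal cn).
have tE : tmax T = w k'.
  case/orP: (updn k' nrb') => [/kmax/=|]; first by rewrite ltnn.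
  move=> /exists_inP[T' TTT' /andP[/eqP lT' /eqP <-]].
  have -> // : T = T'; apply: (lvert_inj tiling) => //.
  by rewrite lT' -[pre w k']/(pre w k.+1) preS -sT -uT.
have TE : step_tile w (Ordinal cn) = T.
  by rewrite /step_tile lk hk; apply: tile_ext; rewrite ?sT ?tE ?uT.
by rewrite TE lk hk -sT -tE.
Qed.

Lemma swept_step w D c : swept w D -> step_tile w c \in TT ->
  (w (lo c) < w (hi c))%N ->
  [/\ step_tile w c \notin D, left_edges (step_tile w c) \subset frontier D
    & swept (wmul w (sigma c)) (D :|: [set step_tile w c])].
Proof.
move=> [cD fD iD uD] TTT up; set T := step_tile w c.
have TD : T \notin D.
  by apply: contra (notin_inversions_up w c) => /iD.
have lT : left_edges T \subset frontier D.
  rewrite fD subUset !sub1set /T; apply/andP; split.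
    by rewrite in_path_edges permK.
  by rewrite in_path_edges permK /= preS_lo.
split=> //; have XT : [set T] \subset TT by rewrite sub1set.
have XD T' : T' \in [set T] -> T' \notin D by rewrite inE => /eqP->.
have Xl T' : T' \in [set T] -> left_edges T' \subset frontier D by rewrite inE => /eqP->.
split; first exact: left_closed_add.
- by rewrite frontier_add// !big_set1 fD path_edges_step.
- move=> T'; rewrite !in_setU inversions_up// in_setU => /orP[/iD->|]; first by rewrite orbT.
  by rewrite inE => /eqP ->; rewrite inE eqxx.
- have new T' : T' \in D -> tmin T = tmin T' -> tmax T = tmax T' -> False.
    move=> /iD + E1 E2; rewrite -E1 -E2; exact/negP/notin_inversions_up.
  move=> T1 T2; rewrite !in_setU !in_set1 => /orP[T1D|/eqP->] /orP[T2D|/eqP->] //.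
  + exact: uD.
  + by move=> /esym E1 /esym E2; case: (new T1).
  + by move=> E1 E2; case: (new T2).
Qed.

(** From a left-over tile a strip would continue through left-over tiles only, as their right edges
    avoid the frontier, here the right boundary; but the defect decreases along it. *)
Lemma swept_w0 D : swept (w0 n) D -> TT \subset D.
Proof.
move=> [cD fD _ _].
suff H m T e : T \in TT -> T \notin D -> e \in right_edges T -> e.2 \notin e.1 ->
    (#|defect e| < m)%N -> False.
  apply/subsetP => T TTT; apply/negPn/negP => TD.
  apply: (H _ T (uvert T, tmax T)) => //; first by rewrite !inE eqxx.
  by have /and3P[] := valid TTT.
elim: m T e => // m IH T [A s] TTT TD eT /= sA; rewrite ltnS => dm.
have eF := frontier_right cD TTT TD eT; rewrite fD path_edges_w0 in eF.
have pe : present TT (A, s).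
  apply/orP; right; apply/exists_inP; exists T => //.
  by rewrite tile_edgesE in_setU eT orbT.
have [T' TTT' eT'] := left_edge_exists tiling pe sA eF.
have [e' e'T' [_ e'n def _]] := strip_next (valid TTT') eT'.
apply: (IH T' e') => //; last exact: leq_trans (proper_card def) dm.
by apply: contra TD => T'D; apply: (cD.2 _ _ _ TTT T'D eT eT').
Qed.

(** Layers are compared with a sweep by single tiles: a tile whose left edges border the first K
    layers belongs to the first K+1. *)
Lemma sweep_all : (exists K, TT \subset (sweep TT K).1) /\
  forall T T', T \in TT -> T' \in TT -> tmin T = tmin T' -> tmax T = tmax T' -> T = T'.
Proof.
suff H m w D K : swept w D -> (#|TT :\: D| < m)%N -> D \subset (sweep TT K).1 ->
    (exists K, TT \subset (sweep TT K).1) /\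
    forall T T', T \in TT -> T' \in TT -> tmin T = tmin T' -> tmax T = tmax T' -> T = T'.
  exact: (H _ _ _ 0%N swept1 (ltnSn _) (sub0set _)).
elim: m w D K => // m IH w D K sw; rewrite ltnS => lm DK.
have [w0E|nw0] := eqVneq w (w0 n).
  rewrite w0E in sw; have TD := swept_w0 sw; split.
    by exists K; apply: subset_trans DK.
  by move=> T T' /(subsetP TD) TT1 /(subsetP TD) TT2; apply: (swept_unique sw).
have [c [TTT up]] := swept_next sw nw0.
have [TD lT sw'] := swept_step sw TTT up.
set T := step_tile w c in TTT TD lT sw'.
have [cK fK] := sweep_inv K.
apply: (IH _ _ K.+1 sw').
  apply: leq_trans lm; apply/proper_card/properP; split; first exact/setDS/subsetUl.
  by exists T; rewrite !(in_setD, in_setU, in_set1) ?eqxx ?orbT ?TTT ?TD.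
rewrite subUset sub1set /= (subset_trans DK (subsetUl _ _)) in_setU /=.
have [//|TK] := boolP (T \in (sweep TT K).1).
rewrite [sweep TT K]surjective_pairing fK layer_ofE// inE TTT TK /=.
apply/subsetP => e eT; have := subsetP lT _ eT; rewrite [e \in frontier D]inE => /andP[h _].
rewrite inE; apply/andP; split.
  case/orP: h => [->//|/exists_inP[T' T'D eT']]; apply/orP; right.
  by apply/exists_inP; exists T' => //; apply: (subsetP DK).
apply/forall_inP => T' T'K; apply/negP => eT'.
by move: TK; rewrite (left_inj TTT (subsetP cK.1 _ T'K) eT eT') T'K.
Qed.

Lemma tile_unique T T' : T \in TT -> T' \in TT ->
  tmin T = tmin T' -> tmax T = tmax T' -> T = T'.
Proof. by case: sweep_all => _; apply. Qed.

Lemma layer_exists T : T \in TT -> exists k, T \in layer TT k.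
Proof.
move=> TTT; case: sweep_all => -[K /subsetP/(_ _ TTT) TK] _.
elim: K TK => [|K IH] /=; first by rewrite inE.
by rewrite in_setU => /orP[/IH//|TL]; exists K.
Qed.

Lemma sweep_mono k k' : (k <= k')%N -> (sweep TT k).1 \subset (sweep TT k').1.
Proof.
elim: k' => [|k' IH]; first by rewrite leqn0 => /eqP ->.
rewrite leq_eqVlt ltnS => /orP[/eqP->//|/IH h].
exact: subset_trans h (subsetUl _ _).
Qed.

Lemma in_layer T k : T \in layer TT k ->
  [/\ T \in TT, T \notin (sweep TT k).1
    & left_edges T \subset frontier (sweep TT k).1].
Proof.
have [ck fk] := sweep_inv k.
by rewrite /layer [sweep TT k]surjective_pairing fk layer_ofE//= inE => /and3P.
Qed.

Lemma layer_lt T T' e k k' : T \in layer TT k -> T' \in layer TT k' ->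
  e \in right_edges T -> e \in left_edges T' -> (k < k')%N.
Proof.
move=> /in_layer[TTT Tk _] /in_layer[TTT' _ /subsetP lT'] eT /lT' eF.
have [ck' _] := sweep_inv k'.
have Tk' : T \in (sweep TT k').1.
  by apply/negPn/negP => Tk'; have := frontier_right ck' TTT Tk' eT; rewrite eF.
by rewrite ltnNge; apply: contra Tk => /sweep_mono/subsetP; apply.
Qed.

Lemma tile_le_next T T' T'' e : T \in TT -> T' \in TT ->
  e \in right_edges T -> e \in left_edges T' -> tile_le TT T' T'' -> tile_le TT T T''.
Proof.
move=> /layer_exists[k Tk] /layer_exists[k' Tk'] eT eT'.
apply: (tile_le_step Tk Tk' (layer_lt Tk Tk' eT eT')).
apply/set0Pn; exists e; by rewrite in_setI !tile_edgesE !(in_setU _ (left_edges _)) eT eT' orbT.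
Qed.

(** As long as t is missing from the lower set, the edge is off the right boundary and the strip
    goes on; only the tile with labels [e.2] and t can insert t. *)
Lemma strip e (t : 'I_n) : present TT e -> e.2 \notin e.1 -> (e.2 < t)%N -> t \notin e.1 ->
  exists T1 T, [/\ T1 \in TT, e \in left_edges T1, T \in TT, tile_le TT T1 T
    & tmin T = e.2 /\ tmax T = t].
Proof.
have [m] := ubnP #|defect e|; elim: m e => // m IH [A s]; rewrite ltnS.
move=> dm pe /= sA st tA.
have nrb : A != [set k : 'I_n | (s < k)%N].
  by apply: contra tA => /eqP ->; rewrite inE.
have [T1 T1T eT1] := left_edge_exists tiling pe sA nrb.
have [e' e'T1 [/= e's e'n def alt]] := strip_next (valid T1T) eT1.
have pe' : present TT e'.
  apply/orP; right; apply/exists_inP; exists T1 => //.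
  by rewrite tile_edgesE in_setU e'T1 orbT.
have next : t \notin e'.1 -> exists T1 T : tile n, [/\ T1 \in TT, (A, s) \in left_edges T1, T \in TT, tile_le TT T1 T
    & tmin T = s /\ tmax T = t].
  move=> te'; have dm' := leq_trans (proper_card def) dm.
  have st' : (e'.2 < t)%N by rewrite e's.
  have [T' [T [T'T eT' TTT le [E1 E2]]]] := IH e' dm' pe' e'n st' te'.
  exists T1, T; split=> //; first exact: tile_le_next T1T T'T e'T1 eT' le.
  by rewrite E1.
case: alt => [[ms e'1]|sub]; last by apply: next; apply: contra tA; apply/subsetP.
have [tE|tne] := eqVneq (tmax T1) t.
  by exists T1, T1; split=> //; constructor.
by apply: next; rewrite e'1 !inE eq_sym (negPf tne).
Qed.

End Sweep.

(** * Lusztig data along words *)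

Fixpoint tiles_from n (w : 'S_n) (i : word n) : seq (tile n) :=
  if i is c :: i' then step_tile w c :: tiles_from (wmul w (sigma c)) i' else [::].

Section Words.
Variable n : nat.
Implicit Types (w v : 'S_n) (c d : 'I_n.-1) (s t u : 'I_n) (i j p q : word n) (T : tile n).

Lemma wmul1 w : wmul w 1%g = w. Proof. by rewrite /wmul mul1g. Qed.
Lemma mul1w w : wmul 1%g w = w. Proof. by rewrite /wmul mulg1. Qed.

Lemma tiles_from_cat w p q :
  tiles_from w (p ++ q) = tiles_from w p ++ tiles_from (wmul w (word_prod p)) q.
Proof.
elim: p w => [|c p IH] w /=; first by rewrite wmul1.
by rewrite IH wmulA.
Qed.

Lemma size_tiles_from w i : size (tiles_from w i) = size i.
Proof. by elim: i w => //= c i IH w; rewrite IH. Qed.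

Lemma wact_simple_root w c :
  wact w (simple_root int c) = root_vec int (w (lo c)) (w (hi c)).
Proof.
rewrite /wact; under eq_bigr do rewrite !mxE eqxx /= scalerBl.
have S s : \sum_k (k == s)%:R *: eps int (w k) = eps int (w s).
  rewrite (bigD1 s)//= eqxx scale1r big1 ?addr0// => k /negPf->.
  by rewrite scale0r.
by rewrite sumrB !S.
Qed.

Lemma roots_fromE w i : roots_from w i = map (@tile_root n) (tiles_from w i).
Proof. by elim: i w => //= c i IH w; rewrite IH wact_simple_root. Qed.

Lemma root_vec_inj s t s' t' : s != t ->
  root_vec int s t = root_vec int s' t' -> s = s' /\ t = t'.
Proof.
move=> st /rowP E; have := E s; have := E t; rewrite !mxE !eqxx /= [t == s]eq_sym (negPf st).
case: (t =P t') => [->|_]; case: (s =P s') => [->|_] //=;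
  by do 2!case: eqP.
Qed.

Lemma ascending_inversions w i : ascending w i ->
  inversions w \subset inversions (wmul w (word_prod i)).
Proof.
elim: i w => [|c i IH] w /=; first by rewrite wmul1.
case/andP => up /IH; rewrite wmulA; apply: subset_trans.
by rewrite inversions_up// subsetUr.
Qed.

Lemma tiles_inversions w i T : ascending w i -> T \in tiles_from w i ->
  (tmin T, tmax T) \in inversions (wmul w (word_prod i)) :\: inversions w.
Proof.
elim: i w => [//|c i IH] w /= /andP[up asc]; rewrite inE wmulA in_setD.
have sub : inversions w \subset inversions (wmul w (sigma c)).
  by rewrite inversions_up// subsetUr.
case/predU1P => [->|/(IH _ asc)]; last first.
  by rewrite in_setD => /andP[h ->]; rewrite andbT; apply: contra h; apply: (subsetP sub).
rewrite notin_inversions_up (subsetP (ascending_inversions asc))//.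
by rewrite inversions_up// setU11.
Qed.

(** Induction along the word, with all edges of the current path present. The strip of [w (lo c)]
    begins with a tile T1 and reaches the label pair of the letter [c], so the root of T1 comes no
    later than that of [c]. An earlier root would be an inversion of w, which no tile with a left
    edge on the path has; hence T1 is the tile of [c]. *)
Lemma tiling_of_tiles (R : realType) i (TT : {set tile n}) :
  tiling_of R i TT -> reduced_word i -> {subset tiles_from 1%g i <= TT}.
Proof.
move=> [tl ord] /reduced_ascending asc.
suff H q p : i = p ++ q -> (forall e, e \in path_edges (word_prod p) -> present TT e) ->
    {subset tiles_from (word_prod p) q <= TT}.
  by apply: (H i [::]) => // e; rewrite /= path_edges1 => eB; rewrite /present eB.
elim: q p => [//|c q IH] p iE pr; set w := word_prod p in pr *.
have := asc; rewrite {1}iE ascending_cat mul1w => /andP[ascp /= /andP[up _]].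
have pe : present TT (pre w c, w (lo c)) by apply: pr; rewrite in_path_edges permK.
have [|||T1 [T [T1T eT1 TTT le [E1 E2]]]] := @strip R n TT tl _ (w (hi c)) pe.
- exact: (notin_pre w (lo c)).
- exact: up.
- by rewrite in_pre permK /= ltnNge leqnSn.
set l := word_roots i.
have lE : l = (map (@tile_root n) (tiles_from 1%g p) ++ [:: tile_root (step_tile w c)])
               ++ map (@tile_root n) (tiles_from (wmul w (sigma c)) q).
  by rewrite /l /word_roots roots_fromE iE tiles_from_cat mul1w map_cat /= -catA.
have tk : take (size p).+1 l = map (@tile_root n) (tiles_from 1%g p) ++ [:: tile_root (step_tile w c)].
  by rewrite lE take_size_cat// size_cat size_map size_tiles_from addn1.
have sl : ((size p).+1 <= size l)%N.
  by rewrite lE !size_cat !size_map !size_tiles_from /= addn1 leq_addr.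
have TE : tile_root T = tile_root (step_tile w c) by rewrite /tile_root E1 E2.
have r1 : tile_root T1 \in take (size p).+1 l.
  rewrite in_take_leq//; apply: leq_ltn_trans (ord _ _ le) _.
  by rewrite -in_take_leq// tk TE mem_cat inE eqxx orbT.
have /and3P[st1 sU1 tU1] := tiling_valid tl T1T.
have nst1 : tmin T1 != tmax T1 by rewrite -val_eqE ltn_eqF.
have stepT : step_tile w c \in TT.
  move: eT1 r1; rewrite tk mem_cat !inE => eT1 /orP[/mapP[T2 T2p]|/eqP].
    move=> /(root_vec_inj nst1) [m1 m2].
    have := tiles_inversions ascp T2p; rewrite mul1w -m1 -m2 in_setD => /andP[_].
    rewrite inversionsE => /andP[_].
    case/orP: eT1 => /eqP[pE wE]; rewrite -wE permK => inv.
      by move: tU1; rewrite -pE in_pre inv.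
    have : tmin T1 \in pre w c by rewrite pE !inE eqxx.
    by rewrite in_pre ltnNge (ltnW inv).
  move=> /(root_vec_inj nst1) [m1 m2].
  case/orP: eT1 => /eqP[pE wE]; last first.
    by have := lo_hi_neq w c; rewrite wE m2 eqxx.
  by rewrite -(_ : T1 = step_tile w c)//; apply: tile_ext.
move=> T'; rewrite inE => /predU1P[->//|].
have -> : wmul w (sigma c) = word_prod (p ++ [:: c]) by rewrite word_prod_cat /= wmul1.
apply: IH; first by rewrite iE -catA.
move=> e; rewrite word_prod_cat /= wmul1 path_edges_step in_setU in_setD.
case/orP => [/andP[_ /pr//]|eR]; apply/orP; right.
by apply/exists_inP; exists (step_tile w c); rewrite // tile_edgesE in_setU eR orbT.
Qed.

End Words.

Definition lusztig_tile n (z : {set 'I_n} -> int) (x : coords n) (T : tile n) : Prop :=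
  (Defs.coord x (tmin T) (tmax T))%:Z = z (overt T) + z (uvert T) - z (lvert T) - z (rvert T).

Definition lusztig_from n (w : 'S_n) (i : word n) (z : {set 'I_n} -> int) (x : coords n) : Prop :=
  forall T, T \in tiles_from w i -> lusztig_tile z x T.

(** * Lusztig data under commutation and braid moves *)

Section Transitions.
Variable n : nat.
Implicit Types (w v : 'S_n) (a b c d : 'I_n.-1) (s t u : 'I_n) (i j p q : word n) (T : tile n).
Implicit Types (z : {set 'I_n} -> int) (x y : coords n).

Lemma lusztig_word (R : realType) i z x :
  reduced_word i -> lusztig R i z x -> lusztig_from 1%g i z x.
Proof.
move=> ri [TT [tl h]] T Ti; apply: h.
exact: (tiling_of_tiles tl ri).
Qed.

Lemma lusztig_from_cat w p q z x : lusztig_from w (p ++ q) z x <->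
  lusztig_from w p z x /\ lusztig_from (wmul w (word_prod p)) q z x.
Proof.
rewrite /lusztig_from tiles_from_cat; split=> [h|[h1 h2] T].
  by split=> T Tp; apply: h; rewrite mem_cat Tp ?orbT.
by rewrite mem_cat => /orP[/h1|/h2].
Qed.

Lemma step_tile_comm w a b : a != b -> ~~ adjacent a b ->
  step_tile (wmul w (sigma a)) b = step_tile w b.
Proof.
rewrite /adjacent -val_eqE /= => ab nab.
rewrite /step_tile !wmulE pre_sigma; last by lia.
by rewrite /sigma !tpermD// -val_eqE /=; lia.
Qed.

Lemma lusztig_from_comm w a b z x : a != b -> ~~ adjacent a b ->
  lusztig_from w [:: a; b] z x <-> lusztig_from w [:: b; a] z x.
Proof.
move=> ab nab; have nba : ~~ adjacent b a by rewrite /adjacent orbC.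
have ba : b != a by rewrite eq_sym.
rewrite /lusztig_from /= (step_tile_comm w ab nab) (step_tile_comm w ba nba).
by split=> h T; rewrite !inE orbC => hT; apply: h; rewrite !inE.
Qed.

Lemma sigma_succ c d : d = c.+1 :> nat ->
  [/\ lo d = hi c, [/\ sigma c (lo c) = hi c, sigma c (hi c) = lo c & sigma c (hi d) = hi d]
    & [/\ sigma d (lo c) = lo c, sigma d (hi c) = hi d & sigma d (hi d) = hi c]].
Proof.
move=> dc; have hl : lo d = hi c by apply: val_inj; rewrite /= dc.
rewrite /sigma hl !tpermL !tpermR !tpermD// -val_eqE /= ?dc; clear; lia.
Qed.

Lemma tiles_braid w c d : d = c.+1 :> nat ->
  let s := w (lo c) in let t := w (hi c) in let u := w (hi d) in let A := pre w c in
  tiles_from w [:: c; d; c] = [:: (s, t, A); (s, u, t |: A); (t, u, A)] /\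
  tiles_from w [:: d; c; d] = [:: (t, u, s |: A); (s, u, A); (s, t, u |: A)].
Proof.
move=> dc s t u A; have [ld [c1 c2 c3] [d1 d2 d3]] := sigma_succ dc.
have cd : (c == d.+1 :> nat) = false by rewrite dc ltn_eqF// ltnS leqW.
have cc : (c == c.+1 :> nat) = false by rewrite ltn_eqF.
have pd v : pre v d = v (lo c) |: pre v c by rewrite dc preS_lo.
rewrite /= /step_tile !wmulE ld ?wmulE !(c1, c2, c3, d1, d2, d3).
by rewrite !pd !wmulE !(c1, d1, d2) !pre_sigma ?dc ?cc //; clear; lia.
Qed.

Lemma coordE x (k l : 'I_n) (kl : (k < l)%N) :
  Defs.coord x k l = x (Sub (k, l) kl : tpair n).
Proof. by rewrite /Defs.coord insubT. Qed.

Lemma coord_braid s t u x (k l : 'I_n) : (k < l)%N ->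
  Defs.coord (braid_map s t u x) k l =
  let m := minn (Defs.coord x s t) (Defs.coord x t u) in
  if (k, l) == (s, t) then (Defs.coord x s t + Defs.coord x s u - m)%N
  else if (k, l) == (s, u) then m
  else if (k, l) == (t, u) then (Defs.coord x t u + Defs.coord x s u - m)%N
  else Defs.coord x k l.
Proof. by move=> kl; rewrite !(coordE _ kl) ffunE. Qed.

(** Only [t |: A] and [s |: (u |: A)] distinguish the vertices of the two tilings, and the Pluecker
    relation gives the sum of z over them. The resulting map of three coordinates is an involution,
    so one formula serves both directions. *)
Lemma lusztig_hexagon z x s t u (A : {set 'I_n}) : BZ_datum z ->
  s \notin A -> t \notin A -> u \notin A -> (s < t)%N -> (t < u)%N ->
  let h1 := [:: (s, t, A); (s, u, t |: A); (t, u, A)] in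
  let h2 := [:: (t, u, s |: A); (s, u, A); (s, t, u |: A)] in
  ((forall T : tile n, T \in h1 -> lusztig_tile z x T) <->
    (forall T : tile n, T \in h2 -> lusztig_tile z (braid_map s t u x) T))
  /\
  ((forall T : tile n, T \in h2 -> lusztig_tile z x T) <->
    (forall T : tile n, T \in h1 -> lusztig_tile z (braid_map s t u x) T)).
Proof.
move=> hz sA tA uA st tu; have su := ltn_trans st tu.
have in3 (T1 T2 T3 : tile n) (P : tile n -> Prop) :
    (forall T, T \in [:: T1; T2; T3] -> P T) <-> P T1 /\ P T2 /\ P T3.
  split=> [h|[p1 [p2 p3]] T]; first by do !split; apply: h; rewrite !inE eqxx ?orbT.
  by rewrite !inE => /or3P[] /eqP ->.
have st' : (s == t) = false by rewrite -val_eqE ltn_eqF.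
have tu' : (t == u) = false by rewrite -val_eqE ltn_eqF.
have su' : (s == u) = false by rewrite -val_eqE ltn_eqF.
have ts' : (t == s) = false by rewrite eq_sym.
have ut' : (u == t) = false by rewrite eq_sym.
cbv zeta; rewrite !in3 /lusztig_tile /overt /uvert /lvert /rvert /tmin /tmax /=.
rewrite !coord_braid//= !xpair_eqE !eqxx !(st', tu', su', ts', ut') /=.
rewrite !(setUCA [set u] [set s]) !(setUCA [set u] [set t]) !(setUCA [set t] [set s]).
have := BZ_pluecker hz sA tA uA st tu.
do 3![move: (Defs.coord x _ _) => ?].
move: (z (s |: (t |: (u |: A)))) (z (s |: (t |: A))) (z (s |: (u |: A))) (z (t |: (u |: A))) => z1 z2 z3 z4.
move: (z (s |: A)) (z (t |: A)) (z (u |: A)) (z A) => z5 z6 z7 z8.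
by clear; lia.
Qed.

Lemma flip_labels s t u (TT TT' : {set tile n}) T : flip s t u TT TT' -> T \in TT' ->
  T \in TT \/ (tmin T, tmax T) \in [:: (s, t); (s, u); (t, u)].
Proof.
move=> [_ _ [A [[_ ->]|[_ ->]]]]; rewrite in_setU in_setD => /orP[/andP[_ ->]|];
  by [left|rewrite !inE -!orbA => /or3P[] /eqP ->; right; rewrite /tmin /tmax /= eqxx ?orbT].
Qed.

(** The flip in a braid transition comes with arbitrary labels. The braid moves three tiles to other
    lower vertices; label pairs being unique in a tiling, the flip must involve all three pairs, and
    the order of the labels leaves a single match. *)
Lemma flip_braid (R : realType) w i j c d s t u (TT TT' : {set tile n}) :
  tiling_of R i TT -> tiling_of R j TT' -> reduced_word i -> reduced_word j ->
  d = c.+1 :> nat -> ascending w [:: c; d; c] ->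
  {subset tiles_from w [:: c; d; c] <= tiles_from 1%g i} ->
  {subset tiles_from w [:: d; c; d] <= tiles_from 1%g j} ->
  flip s t u TT TT' \/ flip s t u TT' TT ->
  [/\ s = w (lo c), t = w (hi c) & u = w (hi d)].
Proof.
move=> tT tT' ri rj dc; have [-> ->] := tiles_braid w dc.
have [ld [c1 c2 c3] [d1 d2 d3]] := sigma_succ dc.
rewrite /= !wmulE ld !(c1, c2, c3, d1, d2, d3) andbT => /and3P[ab ac bc] sub1 sub2 fl.
have key (T T' : tile n) : T \in TT -> T' \in TT' -> tmin T = tmin T' -> tmax T = tmax T' ->
    uvert T != uvert T' -> (tmin T, tmax T) \in [:: (s, t); (s, u); (t, u)].
  move=> TTT TTT' E1 E2 nE; case: fl => fl.
    have [T'T|] := flip_labels fl TTT'; last by rewrite E1 E2.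
    by rewrite (tile_unique tT.1 TTT T'T E1 E2) eqxx in nE.
  have [T'T|//] := flip_labels fl TTT.
  by rewrite (tile_unique tT'.1 T'T TTT' E1 E2) eqxx in nE.
have {}sub1 := fun T h => tiling_of_tiles tT ri (sub1 T h).
have {}sub2 := fun T h => tiling_of_tiles tT' rj (sub2 T h).
have nA (k : 'I_n.-1) : w (lo k) \notin pre w k by exact: (notin_pre w (lo k)).
have nB (x : 'I_n) (A : {set 'I_n}) : x \notin A -> x |: A != A.
  by apply: contra => /eqP <-; rewrite setU11.
have sA : w (lo c) \notin pre w c by rewrite in_pre permK /= ltnn.
have tA : w (hi c) \notin pre w c by rewrite in_pre permK /= ltnNge leqnSn.
have uA : w (hi d) \notin pre w c by rewrite in_pre permK /= dc ltnNge leqW.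
have st : (s < t)%N /\ (t < u)%N by case: fl => -[].
have k1 := key (w (lo c), w (hi c), pre w c) (w (lo c), w (hi c), w (hi d) |: pre w c).
have k2 := key (w (lo c), w (hi d), w (hi c) |: pre w c) (w (lo c), w (hi d), pre w c).
have k3 := key (w (hi c), w (hi d), pre w c) (w (hi c), w (hi d), w (lo c) |: pre w c).
have {}k1 := k1 (sub1 _ _) (sub2 _ _) erefl erefl _.
have {}k2 := k2 (sub1 _ _) (sub2 _ _) erefl erefl _.
have {}k3 := k3 (sub1 _ _) (sub2 _ _) erefl erefl _.
rewrite /uvert /tmin /tmax /= [pre w c == _]eq_sym !nB// in k1.
rewrite /uvert /tmin /tmax /= !nB// in k2.
rewrite /uvert /tmin /tmax /= [pre w c == _]eq_sym !nB// in k3.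
move: k1 k2 k3; rewrite !inE !eqxx ?orbT !xpair_eqE -!val_eqE /=.
move=> /(_ isT isT isT) k1 /(_ isT isT isT) k2 /(_ isT isT isT) k3.
split; apply: val_inj => /=; move: k1 k2 k3 st ab ac bc;
  move: (w (lo c)) (w (hi c)) (w (hi d)) => [a1 ?] [a2 ?] [a3 ?] /=;
  move: (nat_of_ord s) (nat_of_ord t) (nat_of_ord u); clear; lia.
Qed.

(** Along an ascending word every inversion is gained once, so the letters before and after the
    braid use other coordinates. *)
Lemma lusztig_from_braid_other w p q s t u i z x :
  ascending w (p ++ i ++ q) ->
  (forall k l, (k, l) \in [:: (s, t); (s, u); (t, u)] ->
     (k, l) \in inversions (wmul (wmul w (word_prod p)) (word_prod i)) :\: inversions (wmul w (word_prod p))) ->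
  (lusztig_from w p z x <-> lusztig_from w p z (braid_map s t u x)) /\
  (lusztig_from (wmul (wmul w (word_prod p)) (word_prod i)) q z x
   <-> lusztig_from (wmul (wmul w (word_prod p)) (word_prod i)) q z (braid_map s t u x)).
Proof.
rewrite !ascending_cat => /and3P[ap ai aq] h.
have same T : (tmin T, tmax T) \notin [:: (s, t); (s, u); (t, u)] -> (tmin T < tmax T)%N ->
    lusztig_tile z x T <-> lusztig_tile z (braid_map s t u x) T.
  rewrite !inE !negb_or => /and3P[/negPf n1 /negPf n2 /negPf n3] lt.
  by rewrite /lusztig_tile coord_braid// n1 n2 n3.
have sp T : T \in tiles_from w p -> lusztig_tile z x T <-> lusztig_tile z (braid_map s t u x) T.
  move=> /(tiles_inversions ap); rewrite in_setD => /andP[_ iT].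
  apply: same; last by move: iT; rewrite inversionsE => /andP[].
  by apply/negP => /h; rewrite in_setD iT.
have sq T : T \in tiles_from (wmul (wmul w (word_prod p)) (word_prod i)) q ->
    lusztig_tile z x T <-> lusztig_tile z (braid_map s t u x) T.
  move=> /(tiles_inversions aq); rewrite in_setD => /andP[iT iT'].
  apply: same; last by move: iT'; rewrite inversionsE => /andP[].
  by apply/negP => /h; rewrite in_setD => /andP[_ iT'']; rewrite iT'' in iT.
by split; split=> hh T hT; have hx := hh T hT; apply/(sp T hT) || apply/(sq T hT).
Qed.

(** An equivalence, because z is followed forwards to the word beginning with a, and z' backwards to
    it. *)
Lemma lusztig_transition (R : realType) z i x j y : BZ_datum z ->
  transition R i x j y -> reduced_word i ->
  reduced_word j /\ (lusztig_from 1%g i z x <-> lusztig_from 1%g j z y).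
Proof.
move=> hz; elim=> {i x j y} [i x//|i i' a b x j y ab nab _ IH|i i' a b TT TT' s t u x j y ab tT tT' fl _ IH] ri.
  have pE : word_prod [:: a; b] = word_prod [:: b; a].
    by rewrite /= !wmul1; apply: sigma_comm.
  have ri' : reduced_word (i ++ [:: b; a] ++ i').
    case: ri; rewrite !size_cat !word_prod_cat => s1 p1; split.
      by rewrite !size_cat -s1.
    by rewrite !word_prod_cat -pE.
  have [rj <-] := IH ri'; split=> //.
  rewrite ![lusztig_from 1%g (_ ++ _) _ _]lusztig_from_cat.
  by rewrite ![lusztig_from _ (_ ++ i') _ _]lusztig_from_cat pE lusztig_from_comm.
have pE : word_prod [:: a; b; a] = word_prod [:: b; a; b].
  by rewrite /= !wmul1 !wmulA; apply: sigma_braid.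
have ri' : reduced_word (i ++ [:: b; a; b] ++ i').
  case: ri; rewrite !size_cat !word_prod_cat => s1 p1; split.
    by rewrite !size_cat -s1.
  by rewrite !word_prod_cat -pE.
have [rj <-] := IH ri'; split=> //.
have asc := reduced_ascending ri; have asc' := reduced_ascending ri'.
have := asc; rewrite !ascending_cat => /and3P[_ aaba _].
have := asc'; rewrite !ascending_cat => /and3P[_ abab _].
set w := wmul 1%g (word_prod i) in aaba abab.
have sub k : {subset tiles_from w k <= tiles_from 1%g (i ++ k ++ i')}.
  by move=> T hT; rewrite !tiles_from_cat !mem_cat hT orbT.
have labels : [/\ (s < t)%N, (t < u)%N & exists c d, [/\ d = c.+1 :> nat,
    [/\ s = w (lo c), t = w (hi c) & u = w (hi d)]
    & (a = c /\ b = d) \/ (a = d /\ b = c)]].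
  case: (fl) => st tu _; split=> //.
  case/orP: ab => /eqP ab; [exists a, b|exists b, a]; split=> //; [|by left| |by right].
  - by apply: (flip_braid tT tT' ri ri' (esym ab) aaba (sub _) (sub _)); left.
  - by apply: (flip_braid tT' tT ri' ri (esym ab) abab (sub _) (sub _)); right.
have [st tu [c [d [dc [sE tE uE] cases]]]] := labels.
have inv k l : (k, l) \in [:: (s, t); (s, u); (t, u)] ->
    (k, l) \in inversions (wmul w (word_prod [:: a; b; a])) :\: inversions w.
  move=> kl; have [T1 [hT1 E1 E2]] : exists T1, [/\ T1 \in tiles_from w [:: a; b; a], tmin T1 = k & tmax T1 = l].
    have [tl1 tl2] := tiles_braid w dc; case: cases => -[-> ->]; rewrite ?tl1 ?tl2 -sE -tE -uE;
      move: kl; rewrite !inE => /or3P[] /eqP[-> ->].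
    + by exists (s, t, pre w c); rewrite !inE eqxx.
    + by exists (s, u, t |: pre w c); rewrite !inE eqxx orbT.
    + by exists (t, u, pre w c); rewrite !inE eqxx !orbT.
    + by exists (s, t, u |: pre w c); rewrite !inE eqxx !orbT.
    + by exists (s, u, pre w c); rewrite !inE eqxx orbT.
    + by exists (t, u, s |: pre w c); rewrite !inE eqxx.
  by rewrite -E1 -E2; apply: tiles_inversions.
have [op oq] := @lusztig_from_braid_other 1%g i i' s t u _ z x asc inv.
rewrite ![lusztig_from 1%g (_ ++ _) _ _]lusztig_from_cat op.
rewrite ![lusztig_from _ (_ ++ i') _ _]lusztig_from_cat oq pE.
suff -> : lusztig_from w [:: a; b; a] z x
    <-> lusztig_from w [:: b; a; b] z (braid_map s t u x) by [].
have sA : s \notin pre w c by rewrite sE in_pre permK /= ltnn.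
have tA : t \notin pre w c by rewrite tE in_pre permK /= ltnNge leqnSn.
have uA : u \notin pre w c by rewrite uE in_pre permK /= dc ltnNge leqW.
have [H1 H2] := lusztig_hexagon x hz sA tA uA st tu.
have [tl1 tl2] := tiles_braid w dc; rewrite -sE -tE -uE in tl1 tl2.
by rewrite /lusztig_from; case: cases => -[-> ->]; rewrite tl1 tl2.
Qed.
End Transitions.

(** * The action of the Kashiwara operator *)

Section Agreement.
Variables (n : nat) (z z' : {set 'I_n} -> int).
Hypotheses (hz : BZ_datum z) (hz' : BZ_datum z').
Implicit Types (w v : 'S_n) (b c : 'I_n.-1) (S : {set 'I_n}) (q : word n).

Definition agree w : Prop := forall k, z (pre w k) = z' (pre w k).
Definition agree_above w : Prop :=
  forall v, inversions w \subset inversions v -> agree v.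

Lemma agree_above_le w v : inversions w \subset inversions v ->
  agree_above w -> agree_above v.
Proof. by move=> wv h u vu; apply/h/(subset_trans wv). Qed.

Lemma agree_w0 : agree (w0 n).
Proof.
move=> k; have [nk|kn] := leqP n k; first by rewrite preT// !BZ_setT.
case: k kn => [|k] kn; first by rewrite pre0 !BZ_set0.
have kn' : (k < n.-1)%N by rewrite ltn_predRL.
by case: hz hz' => _ /(_ (Ordinal kn')) h _ _ [_ /(_ (Ordinal kn')) h' _ _]; rewrite [LHS]h.
Qed.

Lemma agree_sigma w c : agree w -> z (pre (wmul w (sigma c)) c.+1) = z' (pre (wmul w (sigma c)) c.+1) ->
  agree (wmul w (sigma c)).
Proof. by move=> aw ac k; have [->//|kc] := eqVneq k c.+1; rewrite pre_sigma. Qed.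

Lemma ascending_braid w b c : adjacent b c ->
  (w (lo b) < w (hi b))%N -> (w (lo c) < w (hi c))%N -> ascending w [:: b; c; b].
Proof.
move=> bc; have [e|e] := orP bc; move/eqP: e => /esym e;
  have [ld [c1 c2 c3] [d1 d2 d3]] := sigma_succ e;
  rewrite /= !wmulE ld !(c1, c2, c3, d1, d2, d3) => h1 h2;
  by rewrite h1 h2 andbT (ltn_trans h1 h2) || rewrite h1 h2 andbT (ltn_trans h2 h1).
Qed.

Lemma inversions_sub_up w c : (w (lo c) < w (hi c))%N ->
  inversions w \subset inversions (wmul w (sigma c)).
Proof. by move=> up; rewrite inversions_up// subsetUr. Qed.

(* The reduced words of a permutation are connected by braid moves (Matsumoto);
   here the induction behind this fact is run directly on the set of the
   permutations above [w] in the weak order. *)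
Lemma agree_above_step w b : (w (lo b) < w (hi b))%N -> agree w ->
  agree_above (wmul w (sigma b)) -> agree_above w.
Proof.
have [m] := ubnP #|~: inversions w|; elim: m w b => // m IH w b; rewrite ltnS => wm up aw ab v wv.
have [<-//|nwv] := eqVneq w v.
have [c [upc cv]] := inversions_sub_step wv nwv.
suff : agree_above (wmul w (sigma c)) by apply.
have [->//|cb] := eqVneq c b.
have lt w1 c1 : (w1 (lo c1) < w1 (hi c1))%N -> (#|~: inversions w1| <= m)%N ->
    (#|~: inversions (wmul w1 (sigma c1))| < m)%N.
  move=> up1; apply: leq_trans; rewrite proper_card// properC inversions_up//.
  by rewrite properUr// sub1set notin_inversions_up.
(* For commuting letters w sigma_c sigma_b lies above w sigma_b and has the same set at [c.+1] as w
   sigma_c, so the induction hypothesis applies to w sigma_c. *)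
have [adj|nadj] := boolP (adjacent b c); last first.
  have bc : b != c by rewrite eq_sym.
  have [E1 E2] : (wmul w (sigma c)) (lo b) = w (lo b) /\ (wmul w (sigma c)) (hi b) = w (hi b).
    have nadj' : ~~ adjacent c b by rewrite /adjacent orbC.
    by have [] := step_tile_comm w cb nadj'.
  have [E3 E4] : (wmul w (sigma b)) (lo c) = w (lo c) /\ (wmul w (sigma b)) (hi c) = w (hi c).
    by have [] := step_tile_comm w bc nadj.
  have wE : wmul (wmul w (sigma c)) (sigma b) = wmul (wmul w (sigma b)) (sigma c).
    by rewrite -!wmulA (sigma_comm bc nadj).
  have a2 : agree_above (wmul (wmul w (sigma c)) (sigma b)).
    by rewrite wE; apply: agree_above_le ab; apply: inversions_sub_up; rewrite E3 E4.
  apply: (IH _ b); rewrite ?E1 ?E2//; first exact: lt.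
  apply: agree_sigma => //; have := a2 _ (subxx _) c.+1.
  by rewrite pre_sigma// eqSS.
have adj' : adjacent c b by rewrite /adjacent orbC.
have := ascending_braid adj up upc => /= /and4P[_ b2 b3 _].
have := ascending_braid adj' upc up => /= /and4P[_ c2 c3 _].
set w1 := wmul w (sigma c) in c2 c3 *; set w2 := wmul w1 (sigma b) in c3 *.
have xE : wmul w2 (sigma c) = wmul (wmul (wmul w (sigma b)) (sigma c)) (sigma b).
  by rewrite /w2 /w1 -!wmulA; congr wmul; rewrite !wmulA (sigma_braid adj).
have ax : agree_above (wmul w2 (sigma c)).
  rewrite xE; apply: agree_above_le ab.
  exact: subset_trans (inversions_sub_up b2) (inversions_sub_up b3).
have nbc : b.+1 != c.+1 by rewrite eqSS eq_sym.
(* Around the hexagon all other sets are known to agree, so the Pluecker relation settles this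
   one. *)
have a1c : z (pre w1 c.+1) = z' (pre w1 c.+1).
  have pl y : BZ_datum y -> y (pre (wmul w (sigma b)) b.+1) + y (pre w1 c.+1) =
      Num.min (y (pre w b.+1) + y (pre (wmul (wmul w (sigma b)) (sigma c)) c.+1))
              (y (pre w c.+1) + y (pre w2 b.+1)).
    by case=> _ _ _ h; apply: h => //; apply: ascent_up.
  have p2 : pre w2 b.+1 = pre (wmul w2 (sigma c)) b.+1 by rewrite pre_sigma.
  have := pl _ hz; have := pl _ hz'; rewrite p2 !aw (ab _ (subxx _)) (ax _ (subxx _)).
  by rewrite (ab _ (inversions_sub_up b2)) => <- /addrI.
have a1 : agree w1 by apply: agree_sigma.
have a2 : agree w2.
  apply: agree_sigma => //.
  by rewrite -/w2 -(@pre_sigma _ w2 c b.+1)//; apply: (ax _ (subxx _)).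
have lt1 : (#|~: inversions w1| < m)%N by exact: lt.
apply: (IH _ b) => //; apply: (IH _ c) => //.
exact/lt/ltnW.
Qed.

(** Induction from the end of the word, where (i) fixes the values. One letter earlier the only new
    set is [pre w c.+1], the left vertex of the tile of that letter, whose coordinate determines z
    there. *)
Lemma agree_above_word w q x : ascending w q -> wmul w (word_prod q) = w0 n ->
  lusztig_from w q z x -> lusztig_from w q z' x -> agree_above w.
Proof.
elim: q w => [|c q IH] w /=.
  rewrite wmul1 => _ -> _ _ v sub; have [<-|nv] := eqVneq (w0 n) v; first exact: agree_w0.
  by have [c [+ _]] := inversions_sub_step sub nv; rewrite !w0E /=; clear; lia.
case/andP => up asc; rewrite wmulA => p0 l l'.
have ac : agree_above (wmul w (sigma c)).
  by apply: IH => // T hT; [apply: l|apply: l']; rewrite inE hT orbT.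
apply: (agree_above_step up _ ac).
have aw := ac _ (subxx _).
move=> k; have [->|kc] := eqVneq k c.+1; last by have := aw k; rewrite pre_sigma.
have := l _ (mem_head _ _); have := l' _ (mem_head _ _).
rewrite /lusztig_tile /= => ->; rewrite /overt /uvert /lvert /rvert /tmin /tmax /=.
rewrite [w (lo c) |: (w (hi c) |: _)]setUCA -preS_hi -preS_lo -pre_sigma_c.
have E : z (pre w c.+2) = z' (pre w c.+2).
  by rewrite -(@pre_sigma _ w c c.+2) ?aw // gtn_eqF.
have E' : z (pre w c) = z' (pre w c) by rewrite -(@pre_sigma _ w c c) ?aw // ltn_eqF.
have E'' := aw c.+1.
by rewrite E E' E''; do ![move: (z _) => ?]; do ![move: (z' _) => ?]; clear; lia.
Qed.

Lemma in_wset_sigma c S x : (x \in wset (sigma c) S) = (sigma c x \in S).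
Proof.
by rewrite /wset -{1}(tpermK (lo c) (hi c) x) mem_imset//; apply: perm_inj.
Qed.

(* Among the permutations listing S first, one lists [hi a] before [lo a],
   unless only [lo a] is in S. *)
Lemma agree_off_sigma (a : 'I_n.-1) S : agree_above (sigma a) ->
  ~~ ((lo a \in S) && (hi a \notin S)) -> z S = z' S.
Proof.
move=> ab nS; have lh : (lo a < hi a)%N by [].
have iv v : (v^-1%g (hi a) < v^-1%g (lo a))%N -> agree v.
  move=> va; apply: ab; rewrite -(mul1w (sigma a)) inversions_up ?perm1//.
  by rewrite inversions1 setU0 sub1set inversionsE lh.
have [v vS] := exists_pre S.
have [va|] := ltnP (v^-1%g (hi a)) (v^-1%g (lo a)); first by rewrite -vS iv.
rewrite leq_eqVlt val_eqE (inj_eq perm_inj) -val_eqE (ltn_eqF lh) /= => va.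
have lhS : (lo a \in S) = (hi a \in S).
  apply/idP/idP => [lS|]; first by move: nS; rewrite lS /= negbK.
  by rewrite -vS !in_pre; apply: ltn_trans.
have E : pre (wmul (sigma a) v) #|S| = S.
  apply/setP => x; rewrite in_pre /wmul invMg permM tpermV -in_pre vS.
  by case: tpermP => // ->.
rewrite -E iv// /wmul invMg !permM !tpermV /sigma tpermL tpermR //.
Qed.

End Agreement.

(** * Propagation of the capped difference *)

Section Chains.
Variables (n : nat) (z z' : {set 'I_n} -> int) (a : 'I_n.-1).
Hypotheses (hz : BZ_datum z) (hz' : BZ_datum z').
Hypothesis off : forall S : {set 'I_n}, ~~ ((lo a \in S) && (hi a \notin S)) -> z S = z' S.
Hypothesis at_seg : z' (seg a) = z (seg a) - 1.
Implicit Types (A B S : {set 'I_n}) (u : 'I_n).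

Let diff (y : {set 'I_n} -> int) A : int := y (lo a |: A) - y (hi a |: A).
Let bound : int := diff z (init n a).
(** Says, without naming K, that the two differences are min (c, K) and min (c - 1, K); it is stable
    under taking minima with a common quantity. *)
Let capped A : Prop := diff z A <= bound /\ diff z' A = Num.min (diff z A) (bound - 1).

Lemma lo_neq_hi : lo a != hi a. Proof. by rewrite -val_eqE ltn_eqF. Qed.

Lemma seg_lo : seg a = lo a |: init n a.
Proof. by apply/setP => x; rewrite !inE ltnS leq_eqVlt -val_eqE. Qed.

Lemma off_hi A : z (hi a |: A) = z' (hi a |: A).
Proof. by apply: off; rewrite !inE eqxx andbF. Qed.

Lemma off_notin A : lo a \notin A -> z A = z' A.
Proof. by move=> lA; apply: off; rewrite (negPf lA). Qed.

Lemma capped_init : capped (init n a).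
Proof.
split=> //; rewrite {1}/diff -seg_lo at_seg -off_hi /bound /diff -seg_lo.
by do ![move: (z _) => ?]; clear; lia.
Qed.

(* [diff] of the larger set is the minimum of [diff] of the smaller one and of
   a quantity common to [z] and [z']. *)
Lemma capped_add A u : lo a \notin A -> hi a \notin A -> u \notin A ->
  (hi a < u)%N -> capped A -> capped (u |: A).
Proof.
move=> lA hA uA au; have lh : (lo a < hi a)%N by [].
have lu : (lo a == u) = false by rewrite -val_eqE ltn_eqF// (ltn_trans lh au).
have P y : BZ_datum y -> diff y (u |: A) =
    Num.min (diff y A) (y (u |: A) + y (hi a |: (lo a |: A)) - y (hi a |: A) - y (hi a |: (u |: A))).
  move=> hy; have := BZ_pluecker hy lA hA uA lh au.
  rewrite /diff (setUCA [set lo a] [set hi a]).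
  by do ![move: (y _) => ?]; clear; lia.
rewrite /capped !P// -!off_hi -(off_notin (A := u |: A)); last by rewrite !inE lu.
move: (diff z A) (diff z' A) bound; do ![move: (z _) => ?]; clear => d d' b; lia.
Qed.

(** The Pluecker relation for u < a < a+1: the label now lies below the pair, which reverses the
    roles of [A] and [u |: A]. *)
Lemma capped_del A u : lo a \notin A -> hi a \notin A -> u \notin A ->
  (u < lo a)%N -> capped (u |: A) -> capped A.
Proof.
move=> lA hA uA au; have lh : (lo a < hi a)%N by [].
have lu : (lo a == u) = false by rewrite -val_eqE gtn_eqF.
have P y : BZ_datum y -> diff y A =
    Num.min (diff y (u |: A)) (y (u |: A) + y (hi a |: (lo a |: A)) - y (hi a |: A) - y (hi a |: (u |: A))).
  move=> hy; have := BZ_pluecker hy uA lA hA au lh.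
  rewrite /diff (setUCA [set u] [set hi a]) (setUCA [set u] [set lo a]) (setUCA [set lo a] [set hi a]).
  by do ![move: (y _) => ?]; clear; lia.
rewrite /capped !(P _ hz) !(P _ hz') -!off_hi -(off_notin (A := u |: A)); last by rewrite !inE lu.
move: (diff z (u |: A)) (diff z' (u |: A)) bound; do ![move: (z _) => ?]; clear => d d' b; lia.
Qed.

Lemma capped_sub_init A : A \subset init n a -> capped A.
Proof.
have [m] := ubnP #|init n a :\: A|; elim: m A => // m IH A; rewrite ltnS => Am sub.
have [->|nA] := eqVneq A (init n a); first exact: capped_init.
have /subsetPn[u ui uA] : ~~ (init n a \subset A).
  by apply: contra nA => h; rewrite eqEsubset sub.
have sub' : u |: A \subset init n a by rewrite subUset sub1set ui.
apply: (@capped_del _ u) => //.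
- by apply/negP => /(subsetP sub); rewrite inE ltnn.
- by apply/negP => /(subsetP sub); rewrite inE /= ltnNge leqnSn.
- by move: ui; rewrite inE.
apply: IH => //; apply: leq_trans Am; apply/proper_card/properP.
by split; [exact/setDS/subsetUr|exists u; rewrite !inE ?eqxx// uA; move: ui; rewrite inE].
Qed.

Lemma capped_all A : lo a \notin A -> hi a \notin A -> capped A.
Proof.
have [m] := ubnP #|A :\: init n a|; elim: m A => // m IH A; rewrite ltnS => Am lA hA.
have [sub|/subsetPn[u uA ui]] := boolP (A \subset init n a); first exact: capped_sub_init.
have AE : A = u |: (A :\ u) by rewrite setD1K.
have hu : (hi a < u)%N.
  have ul : u != lo a by apply: contraNneq lA => <-.
  have uh : u != hi a by apply: contraNneq hA => <-.
  by move: ui ul uh; rewrite inE -!val_eqE /=; clear; lia.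
rewrite AE; apply: capped_add; rewrite ?in_setD1 ?eqxx ?(negPf lA) ?(negPf hA) ?andbF//.
apply: IH; rewrite ?in_setD1 ?(negPf lA) ?(negPf hA) ?andbF//.
apply: leq_trans Am; apply/proper_card/properP; split; first exact/setSD/subsetDl.
by exists u; rewrite in_setD ?ui// in_setD1 eqxx.
Qed.

Lemma wset_sigma_lo A : lo a \notin A -> hi a \notin A ->
  wset (sigma a) (lo a |: A) = hi a |: A.
Proof.
move=> lA hA; apply/setP => x; rewrite in_wset_sigma !inE /sigma.
case: tpermP => [->|->|/eqP/negPf xl /eqP/negPf xh].
- by rewrite eq_sym (negPf lo_neq_hi) (negPf lA) (negPf hA).
- by rewrite !eqxx.
- by rewrite xl xh.
Qed.

Lemma kashiwara_formula S : lo a \in S -> hi a \notin S ->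
  z S - z (wset (sigma a) S) <= z (seg a) - z (wset (sigma a) (seg a)) /\
  z S - z' S = if z (seg a) - z (wset (sigma a) (seg a)) <= z S - z (wset (sigma a) S)
               then 1 else 0.
Proof.
move=> lS hS; have lA : lo a \notin S :\ lo a by rewrite in_setD1 eqxx.
have hA : hi a \notin S :\ lo a by rewrite in_setD1 (negPf hS) andbF.
have li : lo a \notin init n a by rewrite inE ltnn.
have hI : hi a \notin init n a by rewrite inE /= ltnNge leqnSn.
have wS : wset (sigma a) S = hi a |: S :\ lo a by rewrite -{1}(setD1K lS) wset_sigma_lo.
have [] := capped_all lA hA; rewrite /bound /diff -off_hi wS seg_lo wset_sigma_lo// setD1K//.
do ![move: (z _) => ?]; move: (z' _) => ?; clear => h1 h2; split=> //.
by case: ifP => ?; lia.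
Qed.
End Chains.

Theorem theorem3p2 (R : realType) (n : nat) (hn : (2 <= n)%N) (a : 'I_n.-1)
    (z z' : {set 'I_n} -> int) (hz : BZ_datum z) (hz' : BZ_datum z')
    (hf : MV_kashiwara a (MV_polytope R z) (MV_polytope R z')) :
  (forall S : {set 'I_n},
     z S - z' S =
       if [&& lo a \in S, hi a \notin S
            & z (seg a) - z (wset (sigma a) (seg a))
              <= z S - z (wset (sigma a) S)]
       then 1 else 0) /\
  (forall S : {set 'I_n},
     lo a \in S -> hi a \notin S ->
     z S - z (wset (sigma a) S) <= z (seg a) - z (wset (sigma a) (seg a))).
Proof.
case: hf => i [y [y' [x [x' [ri [hy Py] [hy' Py'] [lx lx'] [j [x1 [t1 t2]]]]]]]].
have {Py} yE := MV_polytope_inj hz hy Py; have {Py'} yE' := MV_polytope_inj hz' hy' Py'.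
subst y y'.
have [rj [/(_ (lusztig_word ri lx)) lz _]] := lusztig_transition hz t1 ri.
have [_ [_ /(_ (lusztig_word ri lx')) lz']] := lusztig_transition hz' t2 rj.
have := reduced_ascending rj => /= /andP[up asc].
have p0 : wmul (sigma a) (word_prod j) = w0 n by case: rj.
rewrite mul1w in asc.
have ab : agree_above z z' (sigma a).
  apply: (agree_above_word hz hz' asc p0 (x := x1)).
    by move=> T hT; apply: lz; rewrite /= mul1w inE hT orbT.
  (* [incr a] affects only the pair (a, a+1). It is already an inversion of sigma_a, so no tile
     after the first letter carries it. *)
  move=> T hT; have := lz' T; rewrite /= mul1w inE hT orbT => /(_ isT).
  rewrite /lusztig_tile => <-; have := tiles_inversions asc hT.
  rewrite in_setD => /andP[nT]; rewrite inversionsE => /andP[lt _].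
  rewrite !(coordE _ lt) ffunE /=; case: eqP => [E|]; last by rewrite addn0.
  case/negP: nT; rewrite E -(mul1w (sigma a)) inversions_up//.
  by rewrite !perm1 setU11.
have off S := agree_off_sigma ab (S := S).
(* In the first tile the lower, upper and right vertices are covered by [off], so the unit added to
   its coordinate falls on the left vertex, which enters with a minus sign. *)
have at_seg : z' (seg a) = z (seg a) - 1.
  have := lz _ (mem_head _ _); have := lz' _ (mem_head _ _).
  rewrite /lusztig_tile /overt /uvert /lvert /rvert /step_tile /tmin /tmax /= !perm1.
  have lh : (lo a < hi a)%N by [].
  have -> : pre 1%g a = init n a.
    by apply/setP => k; rewrite in_pre inE invg1 perm1.
  rewrite !(coordE _ lh) ffunE /= eqxx -!seg_lo.
  rewrite -(off (init n a)) ?inE ?ltnn// -(off (hi a |: init n a)) ?inE ?eqxx ?andbF//.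
  rewrite -(off (lo a |: (hi a |: init n a))) ?inE ?eqxx ?orbT ?andbF//.
  by do ![move: (z _) => ?]; move: (z' _) => ?; clear; lia.
split=> S; last by move=> lS hS; have [] := kashiwara_formula hz hz' off at_seg lS hS.
have [lS|lS] := boolP (lo a \in S); last by rewrite off ?(negPf lS)// subrr.
have [hS|hS] := boolP (hi a \in S); first by rewrite off ?hS ?andbF// subrr.
by have [_ ->] := kashiwara_formula hz hz' off at_seg lS hS.
Qed.
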